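(* Let $P,Q$ be two distinct points of the plane $\mathbb{R}^2$ and $N=\mathbb{R}^2\setminus\{P,Q\}$. The map that sends the homotopy class (in $N$) of a closed polygonal line $l$ in $N$ to the economical form $e(l)\in E_{2,c}$ of the cyclic Poincaré word of $l$ (taken with respect to any disjoint rays $PP'$ and $QQ'$ starting at $P$ and $Q$ that are in general position with respect to $l$) is a well-defined one-to-one correspondence (bijection) between the set of homotopy classes of closed polygonal lines in $N$ and $E_{2,c}$.
   Context: A closed (oriented) polygonal line in the plane is a finite nonempty sequence $A_1\ldots A_m$ of points of $\mathbb{R}^2$ (its vertices, not necessarily distinct), considered up to cyclic shift. It is a closed polygonal line in $N\subset\mathbb{R}^2$ if all segments $A_1A_2,\ldots,A_{m-1}A_m,A_mA_1$ are contained in $N$ (for $m=1$ this means $A_1\in N$). An elementary cancellation in $N$ of a closed polygonal line in $N$ with at least two vertices is the removal of one vertex $B$ such that, for the vertices $A,C$ adjacent to $B$ in the cyclic sequence (not necessarily distinct), the convex hull of $A,B,C$ is contained in $N$. A (piecewise linear) homotopy in $N$ is a finite sequence of closed polygonal lines in $N$ in which, of any two consecutive polygonal lines, one is obtained from the other by an elementary cancellation in $N$. Two closed polygonal lines are homotopic in $N$ if there is a homotopy in $N$ whose first and last polygonal lines are the given ones; homotopy classes are the classes of this equivalence relation. A ray is in general position with respect to a closed polygonal line $l$ if it does not pass through any vertex of $l$. The sign of the intersection point of an oriented segment $\overrightarrow{AB}$ of $l$ with a ray starting at a point $C$ and in general position with respect to $l$ is $+1$ if the triangle $ABC$ is oriented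 clockwise, and $-1$ otherwise. Cyclic Poincaré word of $l$ (with respect to disjoint rays $PP'$, $QQ'$ in general position with respect to $l$): moving along $l$ in its direction, at every intersection of an oriented segment of $l$ with the ray $PP'$ write $a$ if the sign of the intersection is $+1$ and $a^{-1}$ if it is $-1$; at every intersection with the ray $QQ'$ write $b$ if the sign is $+1$ and $b^{-1}$ if it is $-1$. The resulting (possibly empty) oriented cyclic word in the letters $a,b,a^{-1},b^{-1}$, i.e. a finite word up to cyclic shift, is the cyclic Poincaré word. An elementary cancellation of a cyclic word in the letters $a,b,a^{-1},b^{-1}$ is the replacement of one of the (cyclic) subwords $aa^{-1},a^{-1}a,bb^{-1},b^{-1}b$ by the empty subword. A cyclic word is economical if it has none of these subwords. $E_{2,c}$ is the set of all economical cyclic words (including the empty one). The economical form of a cyclic word is the unique economical cyclic word obtained from it by elementary cancellations. *)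

(* Defs.v *)
From HB Require Import structures.
From Stdlib Require Import Relation_Operators.
From mathcomp Require Import all_boot all_order all_algebra generic_quotient.
From mathcomp Require Import boolp classical_sets functions reals.

Set Implicit Arguments.
Unset Strict Implicit.
Unset Printing Implicit Defensive.

Import Order.TTheory GRing.Theory Num.Theory.

Local Open Scope quotient_scope.
Local Open Scope classical_set_scope.
Local Open Scope ring_scope.

Section CyclicSequences.
Variable T : choiceType.
Implicit Types s t u : seq T.

Definition shift_eq s t : bool :=
  has (fun k => t == rot k s) (iota 0 (size s).+1).

Lemma shift_eqP s t : reflect (exists k, t = rot k s) (shift_eq s t).
Proof.
apply: (iffP hasP) => [[k _ /eqP ->]|[k ->]]; first by exists k.
have [le_ks|lt_sk] := leqP k (size s).
  by exists k; rewrite // mem_iota add0n ltnS.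
by exists 0%N; rewrite ?mem_iota // rot0 rot_oversize // ltnW.
Qed.

Lemma shift_eq_refl : reflexive shift_eq.
Proof. by move=> s; apply/shift_eqP; exists 0%N; rewrite rot0. Qed.

Lemma shift_eq_sym : symmetric shift_eq.
Proof.
suff H s t : shift_eq s t -> shift_eq t s by move=> s t; apply/idP/idP; exact: H.
case/shift_eqP=> k ->; apply/shift_eqP.
by exists (size (rot k s) - k)%N; rewrite -/(rotr k (rot k s)) rotK.
Qed.

Lemma shift_eq_trans : transitive shift_eq.
Proof.
move=> t s u /shift_eqP[k ->] /shift_eqP[l ->]; apply/shift_eqP.
by rewrite rot_rot_add; eexists.
Qed.

Canonical shift_equiv :=
  EquivRel shift_eq shift_eq_refl shift_eq_sym shift_eq_trans.

(* Finite sequences up to cyclic shift. *)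
Definition cseq := {eq_quot shift_equiv}.

Definition cyc s : cseq := \pi_cseq s.

Lemma cycP s t : cyc s = cyc t <-> exists k, t = rot k s.
Proof.
split=> [/eqP|H]; first by rewrite /cyc eqmodE => /shift_eqP.
by apply/eqP; rewrite /cyc eqmodE; apply/shift_eqP.
Qed.

(* The cyclically consecutive pairs (A1,A2), ..., (Am,A1); for m = 1 this is
   the single pair (A1,A1). *)
Definition edges s : seq (T * T) := zip s (rot 1 s).

Lemma edges_rot k s : edges (rot k s) = rot k (edges s).
Proof.
have drop_zip n (a b : seq T) : drop n (zip a b) = zip (drop n a) (drop n b).
  by elim: n a b => [|n IH] [|x a] [|y b] //=; rewrite ?drop0 //; case: drop.
have take_zip n (a b : seq T) : take n (zip a b) = zip (take n a) (take n b).
  by elim: n a b => [|n IH] [|x a] [|y b] //=; rewrite ?IH //; case: take.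
rewrite /edges rot_rot [in RHS]/rot drop_zip take_zip -zip_cat //.
by rewrite !size_drop size_rot.
Qed.

Lemma repr_cyc s : exists k, repr (cyc s) = rot k s.
Proof. by apply/cycP; rewrite /cyc reprK. Qed.

End CyclicSequences.

Section Plane.
Variable R : realType.
Local Notation point := ('rV[R]_2).
Implicit Types (A B C P Q : point) (N : set point).

Definition hull3 A B C : set point :=
  [set X | exists a b c : R, [/\ 0 <= a, 0 <= b, 0 <= c, a + b + c = 1 &
                                 X = a *: A + b *: B + c *: C]].

Definition seg_pt A B (t : R) : point := (1 - t) *: A + t *: B.

Definition segment A B : set point :=
  [set X | exists2 t : R, 0 <= t <= 1 & X = seg_pt A B t].

(* The ray starting at C and passing through C'; it is a genuine ray only
   when C' != C. *)
Definition ray C C' : set point :=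
  [set X | exists2 t : R, 0 <= t & X = C + t *: (C' - C)].

Definition polyline := cseq point.

(* The notions defined below through the representative [repr l] do not depend
   on its choice: see [closed_polyline_cyc], [general_position_cyc] and
   [poincare_word_cyc]. *)
Definition closed_polyline N : set polyline :=
  [set l | repr l != [::] /\
           forall e, e \in edges (repr l) -> segment e.1 e.2 `<=` N].

Lemma closed_polyline_cyc N s :
  closed_polyline N (cyc s) <->
  s != [::] /\ forall e, e \in edges s -> segment e.1 e.2 `<=` N.
Proof.
have [k rE] := repr_cyc s; rewrite /closed_polyline /= rE edges_rot.
rewrite -!size_eq0 size_rot; split=> -[s0 H]; split=> // e es; apply: H;
  by rewrite mem_rot in es *.
Qed.

(* [l] has vertices [B :: s] and [B] is removed; its neighbours are the last
   and the first element of the nonempty sequence [s]. *)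
Definition line_cancel N (l l' : polyline) : Prop :=
  exists (B : point) (s : seq point),
    [/\ s != [::], l = cyc (B :: s), l' = cyc s &
        hull3 (last B s) B (head B s) `<=` N].

Definition homotopic N (l l' : polyline) : Prop :=
  exists h : seq polyline,
    [/\ forall k, k \in l :: h -> closed_polyline N k,
        path (fun k k' => `[< line_cancel N k k' \/ line_cancel N k' k >]) l h
      & last l h = l'].

Definition homotopy_class N (l : polyline) : set polyline :=
  [set l' | homotopic N l l'].

Definition homotopy_classes N : set (set polyline) :=
  [set homotopy_class N l | l in closed_polyline N].

Definition general_position C C' (l : polyline) : Prop :=
  forall A, A \in repr l -> ~ ray C C' A.

Lemma general_position_cyc C C' s :
  general_position C C' (cyc s) <-> forall A, A \in s -> ~ ray C C' A.
Proof.
have [k rE] := repr_cyc s; rewrite /general_position rE.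
by split=> H A As; apply: H; rewrite mem_rot in As *.
Qed.

Definition admissible_rays P Q (l : polyline) P' Q' : Prop :=
  [/\ P' != P, Q' != Q, ray P P' `&` ray Q Q' = set0,
      general_position P P' l & general_position Q Q' l].

(* Twice the signed area of ABC (positive for counterclockwise ABC). *)
Definition orient A B C : R :=
  (B 0 0 - A 0 0) * (C 0 1 - A 0 1) - (B 0 1 - A 0 1) * (C 0 0 - A 0 0).

Definition clockwise A B C : bool := orient A B C < 0.

End Plane.

(* a = (false, false), a^-1 = (false, true), b = (true, false) and
   b^-1 = (true, true). *)
Definition letter := (bool * bool)%type.
Definition letter_inv (x : letter) : letter := (x.1, ~~ x.2).

Definition cword := cseq letter.

Definition word_cancel (w w' : cword) : Prop :=
  exists (x : letter) (s : seq letter),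
    w = cyc [:: x, letter_inv x & s] /\ w' = cyc s.

Definition economical (w : cword) : Prop :=
  ~ exists (x : letter) (s : seq letter), w = cyc [:: x, letter_inv x & s].

Definition economical_words : set cword := [set w | economical w].

Definition economical_form (w v : cword) : Prop :=
  clos_refl_trans cword word_cancel w v /\ economical v.

Section PoincareWord.
Variable R : realType.
Local Notation point := ('rV[R]_2).
Implicit Types (A B C P Q : point).

(* Parameters of the points of the segment AB lying on the ray CC'.  If the
   ray avoids A and B, and C is not on the segment, there is at most one. *)
Definition hits C C' A B : set R :=
  [set t | 0 <= t <= 1 /\ ray C C' (seg_pt A B t)].

Definition crossing_letter (g : bool) C A B : letter := (g, ~~ clockwise A B C).

Definition ray_word (g : bool) C C' A B : seq letter :=
  if `[< hits C C' A B !=set0 >] then [:: crossing_letter g C A B] else [::].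

(* The crossings of AB with the two rays, in the order in which they are met
   when moving from A to B. *)
Definition edge_word P P' Q Q' A B : seq letter :=
  let wa := ray_word false P P' A B in
  let wb := ray_word true Q Q' A B in
  if `[< exists t u, [/\ hits P P' A B t, hits Q Q' A B u & u < t] >]
  then wb ++ wa else wa ++ wb.

Definition poincare_word P P' Q Q' (l : polyline R) : cword :=
  cyc (flatten [seq edge_word P P' Q Q' e.1 e.2 | e <- edges (repr l)]).

Lemma poincare_word_cyc P P' Q Q' s :
  poincare_word P P' Q Q' (cyc s) =
  cyc (flatten [seq edge_word P P' Q Q' e.1 e.2 | e <- edges s]).
Proof.
have [k rE] := repr_cyc s; rewrite /poincare_word rE edges_rot map_rot.
move: [seq _ | _ <- _] => ss; apply/esym/cycP.
exists (size (flatten (take k ss))).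
have -> : flatten ss = flatten (take k ss) ++ flatten (drop k ss).
  by rewrite -flatten_cat cat_take_drop.
by rewrite rot_size_cat -flatten_cat.
Qed.

End PoincareWord.

(* Main.v *)
(* Cutting the plane along the line through P and Q gives two half-planes, and a
   polygonal line is recorded by its passages between them: beyond P (letter
   a^+-1), beyond Q (letter b^+-1) or between P and Q (no letter).  This "line
   word" is invariant under elementary cancellations, because the two sides of a
   triangle in N that leave the half-plane of their far ends pass the line on the
   same side of P and of Q.  Conversely, pushing every vertex to a base point of
   its half-plane turns a polygonal line into a standard loop that is determined
   by its word, so the homotopy class is determined by the economical form, which
   is unique since cancellation of cyclic words satisfies the diamond property.
   Finally, for arbitrary disjoint rays each ray lies in one closed half-plane and
   cuts off a pocket there; along each edge, the Poincare word is the line word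
   conjugated by the letters of the pockets containing the end points, so the two
   cyclic words have the same economical form. *)
Require Import Defs.
From Stdlib Require Import Relation_Operators Operators_Properties.
From mathcomp Require Import all_boot all_order all_algebra generic_quotient.
From mathcomp Require Import boolp classical_sets functions reals.
From mathcomp Require Import ring lra.

Set Implicit Arguments.
Unset Strict Implicit.
Unset Printing Implicit Defensive.

Import Order.TTheory GRing.Theory Num.Theory.

Local Open Scope quotient_scope.
Local Open Scope classical_set_scope.
Local Open Scope ring_scope.

(** * Cyclic sequences and consecutive pairs *)

Section CyclicSequences.
Variable T : choiceType.
Implicit Types s t : seq T.

Lemma cyc_catC s t : cyc (s ++ t) = cyc (t ++ s).
Proof. by apply/cycP; exists (size s); rewrite rot_size_cat. Qed.

Lemma cyc_rcons s x : cyc (rcons s x) = cyc (x :: s).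
Proof. by rewrite -cats1 cyc_catC. Qed.

Lemma cycE (l : cseq T) : exists s, l = cyc s.
Proof. by exists (repr l); rewrite /cyc reprK. Qed.

Lemma size_repr_cyc s : size (repr (cyc s)) = size s.
Proof. by have [k ->] := repr_cyc s; rewrite size_rot. Qed.

Fixpoint consec x s : seq (T * T) :=
  if s is y :: s' then (x, y) :: consec y s' else [::].

Lemma consec_cat x s t : consec x (s ++ t) = consec x s ++ consec (last x s) t.
Proof. by elim: s x => //= y s IH x; rewrite IH. Qed.

Lemma edges_cons x s : edges (x :: s) = consec x (rcons s x).
Proof.
rewrite /edges rot1_cons.
by elim: s {1 3}x => //= y s IH z; rewrite IH.
Qed.

End CyclicSequences.

Lemma cyc_flatten_rot (T : choiceType) (k : nat) (ss : seq (seq T)) :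
  cyc (flatten (rot k ss)) = cyc (flatten ss).
Proof. by rewrite flatten_cat cyc_catC -flatten_cat cat_take_drop. Qed.

(** * Economical forms of cyclic words *)

Lemma letter_invK : involutive letter_inv.
Proof. by case=> a b; rewrite /letter_inv /= negbK. Qed.

Lemma word_cancel_size w w' :
  word_cancel w w' -> size (repr w) = (size (repr w')).+2.
Proof. by case=> x [s [-> ->]]; rewrite !size_repr_cyc. Qed.

Lemma word_cancel_diamond w u v : word_cancel w u -> word_cancel w v ->
  u = v \/ exists2 t, word_cancel u t & word_cancel v t.
Proof.
case=> x [s [-> ->]] [y [t [/cycP[k E] ->]]].
have [x' xE] : exists x', x' = letter_inv x by eexists.
have [y' yE] : exists y', y' = letter_inv y by eexists.
have x'K : letter_inv x' = x by rewrite xE letter_invK.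
have y'K : letter_inv y' = y by rewrite yE letter_invK.
rewrite -xE -yE in E *; rewrite -[RHS]/(@rot letter k _) in E.
have [le_k|lt_k] := leqP (size [:: x, x' & s]) k.
  by left; move: E; rewrite (rot_oversize le_k) => -[_ _ ->].
case: k E lt_k => [|[|k]] E lt_k.
- by left; move: E; rewrite rot0 => -[_ _ ->].
- left; move: E; rewrite rot1_cons /=; case: s lt_k => [|z s] _ /=.
    by case=> _ _ ->.
  by case=> yx' y'z ->; rewrite -y'z yE yx' x'K cyc_rcons.
have {}E : [:: y, y' & t] = drop k s ++ [:: x, x' & take k s] by rewrite E /rot /=.
rewrite -(cat_take_drop k s); move: (take k s) (drop k s) E => p q.
case: q => [|z [|z' q]] /=.
- by case=> _ _ ->; left; rewrite cats0.
- case=> yz y'x ->; left.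
  by rewrite -yz cats1 cyc_rcons -y'K y'x xE.
case=> <- <- ->; right; exists (cyc (p ++ q)).
  by exists y, (q ++ p); rewrite yE; split; rewrite cyc_catC.
by exists x, (p ++ q); rewrite -xE; split; rewrite // cyc_catC.
Qed.

Lemma economical_form_exists w : exists v, economical_form w v.
Proof.
have [n] := ubnP (size (repr w)); elim: n w => // n IH w le_n.
have [ew|/contrapT [x [s wE]]] := pselect (economical w).
  by exists w; split=> //; exact: rt_refl.
have cw : word_cancel w (cyc s) by exists x, s.
have [|v [sv ev]] := IH (cyc s).
  by move: le_n; rewrite (word_cancel_size cw) ltnS => /ltnW.
by exists v; split=> //; apply: rt_trans sv; apply: rt_step.
Qed.

Lemma economical_form_cancel w u v :
  word_cancel w u -> economical_form w v -> economical_form u v.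
Proof.
have [n] := ubnP (size (repr w)).
elim: n w u v => // n IH w u v le_n wu [sv0 ev]; have sv := clos_rt_rt1n _ _ _ _ sv0.
case: sv wu ev {sv0} => [|u' v' wu' sv] wu ev.
  by case: ev; have [x [s [-> _]]] := wu; exists x, s.
have {}sv := clos_rt1n_rt _ _ _ _ sv.
have [->//|[t ut u't]] := word_cancel_diamond wu wu'.
have [||st _] := IH u' t v' _ u't => //.
  by move: le_n; rewrite (word_cancel_size wu') ltnS => /ltnW.
by split=> //; apply: rt_trans st; apply: rt_step.
Qed.

Definition econ (w : cword) : set cword := [set v | economical_form w v].

Lemma econ_cancel w u : word_cancel w u -> econ w = econ u.
Proof.
move=> wu; apply/seteqP; split=> v /=; first exact: economical_form_cancel.
by move=> [sv ev]; split=> //; apply: rt_trans sv; apply: rt_step.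
Qed.

Lemma econ_cancels w u : clos_refl_trans cword word_cancel w u -> econ w = econ u.
Proof. by elim=> [x y /econ_cancel|//|x y z _ -> _ ->]. Qed.

Lemma econ_economical v : economical v -> econ v = [set v].
Proof.
move=> ev; apply/seteqP; split=> [u [vu _]|_ ->]; last by split=> //; exact: rt_refl.
case: (clos_rt_rt1n _ _ _ _ vu) => // y z [x [s [vE _]]].
by case: ev; exists x, s.
Qed.

Lemma econE w v : economical_form w v -> econ w = [set v].
Proof. by case=> sv ev; rewrite (econ_cancels sv) econ_economical. Qed.

(* Equality in the free group, tested in every cyclic context. *)
Definition feq (s t : seq letter) : Prop :=
  forall r, econ (cyc (s ++ r)) = econ (cyc (t ++ r)).

Lemma feq_refl s : feq s s. Proof. by []. Qed.

Lemma feq_sym s t : feq s t -> feq t s.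
Proof. by move=> st r; rewrite st. Qed.

Lemma feq_trans t s u : feq s t -> feq t u -> feq s u.
Proof. by move=> st tu r; rewrite st. Qed.

Lemma feq_ctx p q s t : feq s t -> feq (p ++ s ++ q) (p ++ t ++ q).
Proof.
move=> st r; have cycE u : cyc ((p ++ u ++ q) ++ r) = cyc (u ++ (q ++ r ++ p)).
  by rewrite -!catA cyc_catC -!catA.
by rewrite !cycE st.
Qed.

Lemma feq_cat s t s' t' : feq s t -> feq s' t' -> feq (s ++ s') (t ++ t').
Proof.
move=> st st'; apply: (@feq_trans (s ++ t')).
  by have := feq_ctx s [::] st'; rewrite !cats0.
exact: (feq_ctx [::] t' st).
Qed.

Lemma feq_cyc s t : feq s t -> econ (cyc s) = econ (cyc t).
Proof. by move=> st; have := st [::]; rewrite !cats0. Qed.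

Lemma feq_cancel x : feq [:: x; letter_inv x] [::].
Proof. by move=> r; apply: econ_cancel; exists x, r. Qed.

Definition winv (s : seq letter) : seq letter := rev (map letter_inv s).

Lemma feq_winvr s : feq (s ++ winv s) [::].
Proof.
elim: s => //= x s IH; rewrite /winv /= rev_cons -cats1 catA.
apply: feq_trans (feq_cancel x).
exact: (feq_ctx [:: x] [:: letter_inv x] IH).
Qed.

Lemma feq_winvl s : feq (winv s ++ s) [::].
Proof.
suff -> : winv s ++ s = winv s ++ winv (winv s) by exact: feq_winvr.
by rewrite /winv map_rev revK mapK //; exact: letter_invK.
Qed.

Definition push (x : letter) (r : seq letter) : seq letter :=
  if r is y :: r' then if y == letter_inv x then r' else x :: r else [:: x].

Definition red (s : seq letter) : seq letter := foldr push [::] s.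

Lemma feq_red s : feq s (red s).
Proof.
elim: s => //= x s IH.
apply: (@feq_trans (x :: red s)); first exact: (feq_cat (@feq_refl [:: x]) IH).
rewrite /push; case: (red s) => [|y r] //.
case: eqP => [->|_] //; exact: (feq_ctx [::] r (feq_cancel x)).
Qed.

Lemma feq_of_red s t : red s = red t -> feq s t.
Proof.
by move=> E; apply: feq_trans (feq_red s) _; rewrite E; exact/feq_sym/feq_red.
Qed.

(** * Planar geometry relative to the two punctures *)

Section TwoPunctures.
Variables (R : realType) (P Q : 'rV[R]_2).
Hypothesis hPQ : P != Q.
Local Notation point := ('rV[R]_2).
Local Notation N := (~` [set P; Q] : set point).
Implicit Types (A B C X Y Z : point) (g : bool).

Definition norm2 : R := (Q 0 0 - P 0 0) ^+ 2 + (Q 0 1 - P 0 1) ^+ 2.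

(* [(fx, fy)] are the coordinates of the similarity mapping [P] to [(0, 0)] and
   [Q] to [(1, 0)]. *)
Definition fx X : R :=
  ((X 0 0 - P 0 0) * (Q 0 0 - P 0 0) + (X 0 1 - P 0 1) * (Q 0 1 - P 0 1)) / norm2.

Definition fy X : R :=
  ((Q 0 0 - P 0 0) * (X 0 1 - P 0 1) - (Q 0 1 - P 0 1) * (X 0 0 - P 0 0)) / norm2.

Definition mkpt (x y : R) : point :=
  \row_i if i == 0 then P 0 0 + x * (Q 0 0 - P 0 0) - y * (Q 0 1 - P 0 1)
         else P 0 1 + x * (Q 0 1 - P 0 1) + y * (Q 0 0 - P 0 0).

Definition pt g : point := if g then Q else P.

(* The abscissa seen from the puncture [pt g], increasing towards the other
   puncture: this lets [P] and [Q] be treated alike. *)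
Definition dx g X : R := if g then 1 - fx X else fx X.
Arguments dx : simpl never.

Lemma row2P X Y : X 0 0 = Y 0 0 -> X 0 1 = Y 0 1 -> X = Y.
Proof.
move=> E0 E1; apply/rowP => -[[|[|//]] lt_i].
  by rewrite (_ : Ordinal lt_i = 0) //; apply: val_inj.
by rewrite (_ : Ordinal lt_i = 1) //; apply: val_inj.
Qed.

Lemma norm2_gt0 : 0 < norm2.
Proof.
rewrite /norm2 lt0r addr_ge0 ?sqr_ge0 // andbT paddr_eq0 ?sqr_ge0 //.
rewrite !sqrf_eq0 !subr_eq0; apply: contra hPQ => /andP[/eqP E0 /eqP E1].
by apply/eqP/row2P.
Qed.

Lemma norm2_neq0 : norm2 != 0.
Proof. by rewrite gt_eqF // norm2_gt0. Qed.

Lemma fx_mkpt x y : fx (mkpt x y) = x.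
Proof.
by have := norm2_neq0; rewrite /fx /mkpt !mxE /= /norm2 => h; field.
Qed.

Lemma fy_mkpt x y : fy (mkpt x y) = y.
Proof.
by have := norm2_neq0; rewrite /fy /mkpt !mxE /= /norm2 => h; field.
Qed.

Lemma fxfy_mkpt X : mkpt (fx X) (fy X) = X.
Proof.
have h := norm2_neq0; rewrite /norm2 in h.
by apply: row2P; rewrite !mxE /= /fx /fy /norm2; move: h;
  move: (X 0 0) (X 0 1) (P 0 0) (P 0 1) (Q 0 0) (Q 0 1) => x0 x1 p0 p1 q0 q1 h;
  field.
Qed.

Lemma fx_pt g : fx (pt g) = g%:R.
Proof.
have := norm2_neq0; rewrite /pt /fx /norm2; case: g => h; first by rewrite /=; field.
by rewrite !subrr !mul0r addr0 mul0r.
Qed.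

Lemma fy_pt g : fy (pt g) = 0.
Proof.
have := norm2_neq0; rewrite /pt /fy /norm2; case: g => h; first by rewrite /=; field.
by rewrite !subrr !mulr0 subrr mul0r.
Qed.

Lemma dx_pt g : dx g (pt g) = 0.
Proof. by rewrite /dx fx_pt; case: g; rewrite ?subrr. Qed.

Lemma dx_negb g X : dx (~~ g) X = 1 - dx g X.
Proof. by rewrite /dx; case: g => //=; rewrite subKr. Qed.

Lemma dx_inj g X Y : dx g X = dx g Y -> fy X = fy Y -> X = Y.
Proof.
move=> xE yE; rewrite -(fxfy_mkpt X) -(fxfy_mkpt Y) yE; congr mkpt.
by move: xE; rewrite /dx; case: g => // /(congr1 (fun u => 1 - u)); rewrite !subKr.
Qed.

Lemma eq_pt g X : X = pt g <-> dx g X = 0 /\ fy X = 0.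
Proof.
split=> [->|[xE yE]]; first by rewrite dx_pt fy_pt.
by apply: (@dx_inj g); rewrite ?dx_pt ?fy_pt.
Qed.

Lemma dx_comb g a b c A B C : a + b + c = 1 ->
  dx g (a *: A + b *: B + c *: C) = a * dx g A + b * dx g B + c * dx g C.
Proof.
move=> abc; have -> : a = 1 - b - c by rewrite -abc; ring.
have := norm2_neq0; rewrite /dx /fx /norm2; move: abc => _ h.
by case: g; rewrite !mxE; field.
Qed.

Lemma fy_comb a b c A B C : a + b + c = 1 ->
  fy (a *: A + b *: B + c *: C) = a * fy A + b * fy B + c * fy C.
Proof.
move=> abc; have -> : a = 1 - b - c by rewrite -abc; ring.
have := norm2_neq0; rewrite /fy /norm2; move: abc => _ h.
by rewrite !mxE; field.
Qed.

Lemma seg_pt_comb A B t : seg_pt A B t = (1 - t) *: A + t *: B + 0 *: A.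
Proof. by rewrite scale0r addr0. Qed.

Lemma dx_seg g A B t : dx g (seg_pt A B t) = (1 - t) * dx g A + t * dx g B.
Proof.
by rewrite seg_pt_comb dx_comb ?mul0r ?addr0 // subrK.
Qed.

Lemma fy_seg A B t : fy (seg_pt A B t) = (1 - t) * fy A + t * fy B.
Proof.
by rewrite seg_pt_comb fy_comb ?mul0r ?addr0 // subrK.
Qed.

Lemma rayE g C X :
  ray (pt g) C X <-> exists2 t : R, 0 <= t & dx g X = t * dx g C /\ fy X = t * fy C.
Proof.
have E t : pt g + t *: (C - pt g) = seg_pt (pt g) C t.
  by rewrite /seg_pt scalerBr scalerBl scale1r addrA addrAC.
split=> [[t t0 ->]|[t t0 [xE yE]]]; exists t => //.
  by rewrite E dx_seg fy_seg dx_pt fy_pt !mulr0 !add0r.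
by apply: (@dx_inj g); rewrite E ?dx_seg ?fy_seg ?dx_pt ?fy_pt mulr0 add0r.
Qed.

Definition det g A B : R := dx g A * fy B - dx g B * fy A.

Lemma detC g A B : det g B A = - det g A B.
Proof. by rewrite /det; ring. Qed.

Lemma det_negb g A B : det (~~ g) A B = fy B - fy A - det g A B.
Proof. by rewrite /det !dx_negb; ring. Qed.

Lemma clockwise_det g A B :
  clockwise A B (pt g) = if g then 0 < det g A B else det g A B < 0.
Proof.
have oE : orient A B (pt g) = norm2 * (if g then - det g A B else det g A B).
  have := norm2_neq0; rewrite /det /dx /fx /fy /norm2 /pt /orient.
  by case: g => h; field.
rewrite /clockwise oE pmulr_rlt0 ?norm2_gt0 //.
by case: g {oE} => //; rewrite oppr_lt0.
Qed.

(** * Hulls and segments avoiding the punctures *)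

Lemma NP X : N X <-> forall g, X <> pt g.
Proof.
split=> [NX [] E|NX []] ; first by apply: NX; right.
- by apply: NX; left.
- exact: (NX false).
- exact: (NX true).
Qed.

Definition misses3 g A B C := forall a b c : R,
  0 <= a -> 0 <= b -> 0 <= c -> 0 < a + b + c ->
  a * dx g A + b * dx g B + c * dx g C = 0 ->
  a * fy A + b * fy B + c * fy C = 0 -> False.

Definition misses2 g A B := forall a b : R, 0 <= a -> 0 <= b -> 0 < a + b ->
  a * dx g A + b * dx g B = 0 -> a * fy A + b * fy B = 0 -> False.

Lemma hullN A B C : hull3 A B C `<=` N <-> forall g, misses3 g A B C.
Proof.
split=> [H g a b c a0 b0 c0 s0 xE yE|H X [a [b [c [a0 b0 c0 s1 ->]]]]].
  pose s := a + b + c; have sn0 : s != 0 by rewrite gt_eqF.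
  have s1 : a / s + b / s + c / s = 1 by rewrite /s; field.
  have /NP/(_ g)/eq_pt : N (a / s *: A + b / s *: B + c / s *: C).
    apply: H; exists (a / s), (b / s), (c / s).
    by split=> //; rewrite divr_ge0 // ltW.
  rewrite dx_comb // fy_comb //; apply; split.
    by rewrite -[RHS](mul0r s^-1) -xE; ring.
  by rewrite -[RHS](mul0r s^-1) -yE; ring.
apply/NP => g /eq_pt; rewrite dx_comb // fy_comb // => -[xE yE].
by apply: (H g a b c); rewrite // s1 ltr01.
Qed.

Lemma segN A B : segment A B `<=` N <-> forall g, misses2 g A B.
Proof.
split=> [H g a b a0 b0 s0 xE yE|H X [t /andP[t0 t1] ->]].
  pose s := a + b; have sn0 : s != 0 by rewrite gt_eqF.
  have s1 : 1 - b / s = a / s by rewrite /s; field.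
  have /NP/(_ g)/eq_pt : N (seg_pt A B (b / s)).
    apply: H; exists (b / s) => //.
    by rewrite divr_ge0 ?(ltW s0) //= ler_pdivrMr // mul1r lerDr.
  rewrite dx_seg fy_seg s1; apply; split.
    by rewrite -[RHS](mul0r s^-1) -xE; ring.
  by rewrite -[RHS](mul0r s^-1) -yE; ring.
apply/NP => g /eq_pt; rewrite dx_seg fy_seg => -[xE yE].
by apply: (H g (1 - t) t); rewrite ?subr_ge0 // subrK ltr01.
Qed.

Lemma hullNC A B C : hull3 A B C `<=` N -> hull3 B C A `<=` N.
Proof.
move=> /hullN H; apply/hullN => g a b c a0 b0 c0 s0 xE yE.
by apply: (H g c a b) => //; lra.
Qed.

Lemma hullN_rev A B C : hull3 A B C `<=` N -> hull3 C B A `<=` N.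
Proof.
move=> /hullN H; apply/hullN => g a b c a0 b0 c0 s0 xE yE.
by apply: (H g c b a) => //; lra.
Qed.

Lemma segN_sym A B : segment A B `<=` N -> segment B A `<=` N.
Proof.
move=> /segN H; apply/segN => g a b a0 b0 s0 xE yE.
by apply: (H g b a) => //; lra.
Qed.

Lemma hullN_seg A B C : hull3 A B C `<=` N -> segment A B `<=` N.
Proof.
move=> /hullN H; apply/segN => g a b a0 b0 s0 xE yE.
by apply: (H g a b 0) => //; lra.
Qed.

Lemma segN_hull A Z B t : segment A B `<=` N -> 0 <= t <= 1 ->
  Z = seg_pt A B t -> hull3 A Z B `<=` N.
Proof.
move=> /segN H /andP[t0 t1] ->; apply/hullN => g a b c a0 b0 c0 s0.
rewrite dx_seg fy_seg => xE yE.
have bt0 : 0 <= b * t by rewrite mulr_ge0.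
have bs0 : 0 <= b * (1 - t) by rewrite mulr_ge0 // subr_ge0.
by apply: (H g (a + b * (1 - t)) (c + b * t)); lra.
Qed.

Lemma hullN_AAB A B : segment A B `<=` N -> hull3 A A B `<=` N.
Proof.
move=> AB; apply: (segN_hull (t := 0) AB); rewrite ?lexx ?ler01 //.
by rewrite /seg_pt subr0 scale1r scale0r addr0.
Qed.

Lemma hullN_ABA A B : segment A B `<=` N -> hull3 A B A `<=` N.
Proof. by move=> /hullN_AAB/hullNC. Qed.

Definition up X : bool := 0 <= fy X.

(* [AB] crosses the line through the punctures, and [pt g] separates the crossing
   point from the other puncture. *)
Definition beyond g A B : bool :=
  (up A != up B) && (if up A then 0 < det g A B else det g A B < 0).

Lemma det_neq0 g A B : segment A B `<=` N -> up A != up B -> det g A B != 0.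
Proof.
move=> /segN/(_ g) H; rewrite /up => nU; apply/eqP; rewrite /det => o0.
have := H (- fy B) (fy A); have := H (fy B) (- fy A).
move: nU o0; case: (leP 0 (fy A)) => a0; case: (leP 0 (fy B)) => b0 // _ o0 H1 H2.
  by apply: H2; lra.
by apply: H1; lra.
Qed.

Lemma beyond_sym g A B : beyond g B A = beyond g A B.
Proof.
rewrite /beyond eq_sym detC oppr_gt0 oppr_lt0.
by case: (up A); case: (up B).
Qed.

Lemma beyond_excl A B : ~~ (beyond false A B && beyond true A B).
Proof.
rewrite /beyond (det_negb false) /up.
by apply/negP => /andP[]; case: (leP 0 (fy A)) => a0;
  case: (leP 0 (fy B)) => b0 //=; lra.
Qed.

(* Otherwise the puncture lies between the points where [AB] and [BC] cross the
   line, hence in the triangle. *)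
Lemma beyond_apex g A B C : hull3 A B C `<=` N -> up A != up B -> up B != up C ->
  beyond g A B = beyond g B C.
Proof.
move=> H nAB nBC.
have := det_neq0 g (hullN_seg H) nAB.
have := det_neq0 g (hullN_seg (hullNC H)) nBC.
have /hullN/(_ g) := H.
rewrite /misses3 => Hg.
set u := det g A B; set v := det g B C => vn0 un0.
have same_sign : 0 <= u * v -> False.
  (* Up to a common factor, [a], [b], [c] are barycentric coordinates of [pt g]. *)
  move=> uv; pose a := - fy B * v; pose b := fy A * v + fy C * u.
  pose c := - fy B * u.
  have xE : a * dx g A + b * dx g B + c * dx g C = 0.
    by rewrite /a /b /c /u /v /det; ring.
  have yE : a * fy A + b * fy B + c * fy C = 0.
    by rewrite /a /b /c /u /v /det; ring.
  have H1 := Hg a b c; have H2 := Hg (- a) (- b) (- c).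
  move: nAB nBC; rewrite /up.
  case: (leP 0 (fy A)) => a0; case: (leP 0 (fy B)) => b0 // _;
    case: (leP 0 (fy C)) => c0 // _;
    case: (ltrgt0P u) un0 => // u0 _; case: (ltrgt0P v) vn0 => // v0 _;
    try by move: uv; rewrite leNgt ?(pmulr_rlt0 _ u0) ?(nmulr_rlt0 _ u0) v0.
  - by apply: H1 => //; rewrite /a /b /c; nra.
  - by apply: H2; [rewrite /a; nra | rewrite /b; nra | rewrite /c; nra
                  | rewrite /a /b /c; nra | lra | lra].
  - by apply: H2; [rewrite /a; nra | rewrite /b; nra | rewrite /c; nra
                  | rewrite /a /b /c; nra | lra | lra].
  - by apply: H1 => //; rewrite /a /b /c; nra.
rewrite /beyond nAB nBC /=.
case: (up A) (up B) nAB => -[] // _; case: (ltrgt0P u) un0 => // u0 _;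
  case: (ltrgt0P v) vn0 => // v0 _; exfalso; apply: same_sign; nra.
Qed.

(** * The word of a polygonal line relative to the line through the punctures *)

Definition w0 A B : seq letter :=
  (if beyond false A B then [:: (false, up A)] else [::]) ++
  (if beyond true A B then [:: (true, ~~ up A)] else [::]).

Lemma w0_triangle A B C : hull3 A B C `<=` N -> feq (w0 A B ++ w0 B C) (w0 A C).
Proof.
move=> H; apply: feq_of_red; rewrite /w0.
have same g X Y : (up X == up Y) ==> ~~ beyond g X Y.
  by rewrite /beyond; case: eqP.
have apex g X Y Z : hull3 X Y Z `<=` N ->
    (up X != up Y) ==> (up Y != up Z) ==> (beyond g X Y == beyond g Y Z).
  by move=> hull; apply/implyP => nXY; apply/implyP => nYZ; apply/eqP/beyond_apex.
have := beyond_excl A B; have := beyond_excl B C; have := beyond_excl A C.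
have := same false A B; have := same false B C; have := same false A C.
have := same true A B; have := same true B C; have := same true A C.
have := apex false A B C H; have := apex true A B C H.
have := apex false B C A (hullNC H); have := apex true B C A (hullNC H).
have := apex false C A B (hullNC (hullNC H)).
have := apex true C A B (hullNC (hullNC H)).
rewrite !(beyond_sym _ A C).
case: (beyond false A B) (beyond false B C) (beyond false A C) => [] [] [] //=;
case: (beyond true A B) (beyond true B C) (beyond true A C) => [] [] [] //=;
by case: (up A) (up B) (up C) => [] [] [].
Qed.

Definition eword (f : point -> point -> seq letter) (es : seq (point * point)) :
  seq letter := flatten [seq f e.1 e.2 | e <- es].

Lemma eword_cat f es es' : eword f (es ++ es') = eword f es ++ eword f es'.
Proof. by rewrite /eword map_cat flatten_cat. Qed.

Lemma cyc_eword_repr f s :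
  cyc (eword f (edges (repr (cyc s)))) = cyc (eword f (edges s)).
Proof.
by have [k ->] := repr_cyc s; rewrite edges_rot /eword map_rot cyc_flatten_rot.
Qed.

Definition line_word (l : polyline R) : cword := cyc (eword w0 (edges (repr l))).

Lemma econ_line_cancel l l' : line_cancel N l l' ->
  econ (line_word l) = econ (line_word l').
Proof.
case=> B [] [|C s] [] // _ -> -> /= H; rewrite /line_word !cyc_eword_repr.
rewrite !edges_cons -!cats1 /= !consec_cat /= /eword /= !map_cat !flatten_cat /= !cats0.
set W := flatten _.
rewrite cyc_catC -catA; apply/feq_cyc.
by have := feq_ctx W [::] (w0_triangle H); rewrite !cats0.
Qed.

(** * Homotopy as an equivalence relation *)

Implicit Types (l : polyline R) (p q r s : seq point).

Lemma closed_cancel l l' : line_cancel N l l' ->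
  closed_polyline N l <-> closed_polyline N l'.
Proof.
case=> B [] [|C s] [] // _ -> -> /= H; rewrite !closed_polyline_cyc.
rewrite !edges_cons -!cats1 /= !consec_cat /=; set A := last C s in H *.
have [AB BC CA] : [/\ segment A B `<=` N, segment B C `<=` N & segment A C `<=` N].
  split; [exact: hullN_seg H | exact: hullN_seg (hullNC H)|].
  exact: hullN_seg (hullNC (hullNC (hullN_rev H))).
split=> -[_ E]; split=> // e.
  rewrite mem_cat inE => /orP[es|/eqP -> //].
  by apply: E; rewrite inE mem_cat es orbT.
rewrite inE mem_cat inE => /or3P[/eqP ->//|es|/eqP -> //].
by apply: E; rewrite mem_cat es.
Qed.

Lemma homotopic_refl l : closed_polyline N l -> homotopic N l l.
Proof. by move=> Nl; exists [::]; split=> // k; rewrite inE => /eqP ->. Qed.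

Lemma homotopic_closed l l' : homotopic N l l' ->
  closed_polyline N l /\ closed_polyline N l'.
Proof.
by case=> h [H _ <-]; split; apply: H; rewrite ?mem_head ?mem_last.
Qed.

Lemma homotopic_cons l k l' : closed_polyline N l ->
  line_cancel N l k \/ line_cancel N k l -> homotopic N k l' -> homotopic N l l'.
Proof.
move=> Nl lk [h [H hp hl]]; exists (k :: h); split=> //=.
  by move=> m; rewrite inE => /orP[/eqP -> //|]; exact: H.
by rewrite hp andbT; apply/asboolP.
Qed.

Lemma homotopic_ind (S : polyline R -> polyline R -> Prop) :
  (forall l, closed_polyline N l -> S l l) ->
  (forall l k l', closed_polyline N l -> line_cancel N l k \/ line_cancel N k l ->
     homotopic N k l' -> S k l' -> S l l') ->
  forall l l', homotopic N l l' -> S l l'.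
Proof.
move=> S0 S1 l l' [h]; elim: h l => [|k h IH] l [H hp hl].
  by rewrite -hl; apply/S0/H; rewrite mem_head.
move: hp => /= /andP[/asboolP lk hp].
have kl' : homotopic N k l'.
  by exists h; split=> // m mh; apply: H; rewrite inE mh orbT.
apply: S1 lk kl' _; first by apply: H; rewrite mem_head.
by apply: IH; split=> // m mh; apply: H; rewrite inE mh orbT.
Qed.

Lemma homotopic_trans k l m : homotopic N k l -> homotopic N l m -> homotopic N k m.
Proof.
move=> kl; elim/homotopic_ind: kl m => // a b c Na ab _ IH m cm.
exact: homotopic_cons Na ab (IH m cm).
Qed.

Lemma homotopic_step l l' : closed_polyline N l ->
  line_cancel N l l' \/ line_cancel N l' l -> homotopic N l l'.
Proof.
move=> Nl ll'; apply: (homotopic_cons Nl ll'); apply: homotopic_refl.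
by case: ll' => /closed_cancel c; apply/c.
Qed.

Lemma homotopic_sym l l' : homotopic N l l' -> homotopic N l' l.
Proof.
elim/homotopic_ind => [m|a b c Na ab _ ca]; first exact: homotopic_refl.
apply: homotopic_trans ca _; apply: homotopic_step; last by case: ab; [right|left].
by case: ab => /closed_cancel c'; apply/c'.
Qed.

Lemma econ_homotopic l l' :
  homotopic N l l' -> econ (line_word l) = econ (line_word l').
Proof. by elim/homotopic_ind => // a b c _ [] /econ_line_cancel ->. Qed.

(** * Homotopies of arcs *)

(* [p] and [q] may be exchanged inside every closed polygonal line. *)
Definition peq p q : Prop := forall r,
  closed_polyline N (cyc (p ++ r)) \/ closed_polyline N (cyc (q ++ r)) ->
  homotopic N (cyc (p ++ r)) (cyc (q ++ r)).

Lemma peq_sym p q : peq p q -> peq q p.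
Proof. by move=> pq r /or_comm/pq/homotopic_sym. Qed.

Lemma peq_trans p q s : peq p q -> peq q s -> peq p s.
Proof.
move=> pq qs r [Np|Ns].
  have h := pq r (or_introl Np).
  have [_ Nq] := homotopic_closed h.
  exact: homotopic_trans h (qs r (or_introl Nq)).
have h := qs r (or_intror Ns).
have [Nq _] := homotopic_closed h.
exact: homotopic_trans (pq r (or_intror Nq)) h.
Qed.

Lemma peq_refl p : peq p p.
Proof. by move=> r [] /homotopic_refl. Qed.

Lemma peq_ctx a b p q : peq p q -> peq (a ++ p ++ b) (a ++ q ++ b).
Proof.
move=> pq r; have cycE u : cyc ((a ++ u ++ b) ++ r) = cyc (u ++ (b ++ r ++ a)).
  by rewrite -!catA cyc_catC -!catA.
by rewrite !cycE; exact: pq.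
Qed.
Arguments peq_ctx a b [p q] _ _ _.

Lemma peq_line p q : peq p q ->
  closed_polyline N (cyc p) \/ closed_polyline N (cyc q) -> homotopic N (cyc p) (cyc q).
Proof. by move=> /(_ [::]); rewrite !cats0. Qed.

Lemma peq_step p q : (forall r, closed_polyline N (cyc (p ++ r)) \/
    closed_polyline N (cyc (q ++ r)) -> line_cancel N (cyc (p ++ r)) (cyc (q ++ r))) ->
  peq p q.
Proof.
move=> H r Nr; have c := H r Nr; apply: homotopic_step; last by left.
by case: Nr => // Nq; apply/(closed_cancel c).
Qed.

Lemma peq_cancel A B C : hull3 A B C `<=` N -> peq [:: A; B; C] [:: A; C].
Proof.
move=> H; apply: peq_step => r _; exists B, (C :: r ++ [:: A]); split=> //=.
- by rewrite (cyc_catC [:: A] [:: B, C & r]).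
- by rewrite (cyc_catC [:: A] (C :: r)).
- by rewrite cats1 last_rcons.
Qed.

Lemma peq_dup A : peq [:: A; A] [:: A].
Proof.
apply: peq_step => r Nr; exists A, (A :: r); split=> //=.
have {}Nr : segment (last A r) A `<=` N.
  by case: Nr => /closed_polyline_cyc[_]; rewrite edges_cons -cats1 consec_cat /= => E;
     apply: (E (last A r, A)); rewrite ?inE mem_cat mem_seq1 eqxx ?orbT.
exact: hullN_rev (hullN_AAB (segN_sym Nr)).
Qed.

Lemma peq_back A B : segment A B `<=` N -> peq [:: A; B; A] [:: A].
Proof. by move=> /hullN_ABA/peq_cancel AB; exact: peq_trans AB (@peq_dup A). Qed.

(** * Standard loops *)

Definition base (b : bool) : point := mkpt (2^-1) (if b then 1 else -1).
Definition gate g : point := mkpt (if g then 2 else -1) 0.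
Definition mid : point := mkpt (2^-1) 0.
Local Notation u := (base true).
Local Notation d := (base false).

Definition wside (b : bool) X : Prop := if b then 0 <= fy X else fy X <= 0.

Lemma wside_up X : wside (up X) X.
Proof. by rewrite /wside /up; case: leP => // /ltW. Qed.

Lemma wside0 b X : fy X = 0 -> wside b X.
Proof. by rewrite /wside => ->; case: b. Qed.

Lemma fy_base b : fy (base b) = if b then 1 else -1.
Proof. by rewrite fy_mkpt. Qed.

Lemma dx_base g b : dx g (base b) = 2^-1.
Proof. by rewrite /dx fx_mkpt; case: g => //; lra. Qed.

Lemma dx_mid g : dx g mid = 2^-1.
Proof. by rewrite /dx fx_mkpt; case: g => //; lra. Qed.

Lemma dx_gate g g' : dx g' (gate g) = if g == g' then -1 else 2.
Proof. by rewrite /dx fx_mkpt; case: g; case: g' => /=; lra. Qed.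

Lemma fy_gate g : fy (gate g) = 0.
Proof. by rewrite fy_mkpt. Qed.

Lemma up_base b : up (base b) = b.
Proof. by rewrite /up fy_base; case: b; rewrite ?ler01 // ler0N1. Qed.

Lemma up_gate g : up (gate g).
Proof. by rewrite /up fy_gate. Qed.

Lemma segNN A : N A -> segment A A `<=` N.
Proof.
by move=> NA _ [t _ ->]; rewrite /seg_pt -scalerDl subrK scale1r.
Qed.

Lemma segN_side A B : (forall g, 0 < dx g A * dx g B) -> segment A B `<=` N.
Proof.
move=> H; apply/segN => g a b a0 b0 s0 xE _; have := H g.
case: (ltrgt0P (dx g A)) => A0; last by rewrite A0 mul0r ltxx.
  rewrite pmulr_rgt0 // => B0.
  have := mulr_ge0 a0 (ltW A0); have := mulr_ge0 b0 (ltW B0).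
  move: a0; rewrite le_eqVlt => /predU1P[a0|a0]; last by have := mulr_gt0 a0 A0; lra.
  have b1 : 0 < b by lra.
  by have := mulr_gt0 b1 B0; lra.
rewrite nmulr_rgt0 // => B0; have := mulr_ge0_le0 a0 (ltW A0).
have := mulr_ge0_le0 b0 (ltW B0).
move: a0; rewrite le_eqVlt => /predU1P[a0|a0]; first last.
  have : a * dx g A < 0 by rewrite pmulr_rlt0.
  lra.
have b1 : 0 < b by lra.
have : b * dx g B < 0 by rewrite pmulr_rlt0.
lra.
Qed.

Lemma N_of_dx A : (forall g, dx g A != 0) -> N A.
Proof. by move=> H; apply/NP => g /eq_pt[xE _]; have := H g; rewrite xE eqxx. Qed.

Lemma N_gate g : N (gate g).
Proof.
apply: N_of_dx => g'; rewrite dx_gate.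
by case: (g == g'); rewrite ?oppr_eq0 ?oner_eq0 ?pnatr_eq0.
Qed.

Lemma segN_base b b' : segment (base b) (base b') `<=` N.
Proof. by apply: segN_side => g; rewrite !dx_base; lra. Qed.

Lemma side_hull b A B : wside b A -> wside b B -> segment A B `<=` N ->
  hull3 A (base b) B `<=` N.
Proof.
move=> wA wB /segN H; apply/hullN => g x y z x0 y0 z0 s0; rewrite dx_base => xE yE.
have yB : y = 0.
  move: wA wB yE; rewrite /wside fy_base.
  case: b => wA wB; first by have := mulr_ge0 x0 wA; have := mulr_ge0 z0 wB; lra.
  by have := mulr_ge0_le0 x0 wA; have := mulr_ge0_le0 z0 wB; lra.
by move: xE yE s0; rewrite yB !mul0r !addr0 => xE yE s0; apply: (H g x z).
Qed.

Lemma side_seg b A : wside b A -> N A -> segment A (base b) `<=` N.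
Proof. by move=> wA NA; apply: hullN_seg (side_hull wA wA (segNN NA)). Qed.

Lemma crossing_point A B : segment A B `<=` N -> up A != up B ->
  exists2 Z, [/\ hull3 A Z B `<=` N, segment A Z `<=` N & segment Z B `<=` N] &
    fy Z = 0 /\ forall g, dx g Z != 0 /\ beyond g A B = (dx g Z < 0).
Proof.
move=> AB nU; pose t := fy A / (fy A - fy B).
have yn : fy A - fy B != 0.
  by apply/eqP => /eqP; rewrite subr_eq0 => /eqP yE; rewrite /up yE eqxx in nU.
have t01 : 0 <= t <= 1.
  move: nU yn; rewrite /t /up; case: (leP 0 (fy A)) => a0;
    case: (leP 0 (fy B)) => b0 // _ yn.
    by apply/andP; split; [apply: divr_ge0; lra | rewrite ler_pdivrMr ?mul1r; lra].
  rewrite -mulrNN -invrN; apply/andP; split; first by apply: divr_ge0; lra.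
  by rewrite ler_pdivrMr ?mul1r; lra.
have H := segN_hull AB t01 (erefl _).
have dxZ g : dx g (seg_pt A B t) = det g A B / (fy B - fy A).
  by rewrite dx_seg /t /det; field; lra.
exists (seg_pt A B t).
  by split=> //; [exact: hullN_seg H | exact: hullN_seg (hullNC H)].
split=> [|g]; first by rewrite fy_seg /t; field.
rewrite dxZ mulf_neq0 ?(det_neq0 _ AB) ?invr_eq0 //; last by rewrite -oppr_eq0 opprB.
split=> //; rewrite /beyond nU /=.
move: nU yn; rewrite /up; case: (leP 0 (fy A)) => a0;
  case: (leP 0 (fy B)) => b0 // _ yn.
  by rewrite nmulr_llt0 // invr_lt0; lra.
by rewrite pmulr_llt0 // invr_gt0; lra.
Qed.

Lemma crossing_arc A B : segment A B `<=` N -> up A != up B ->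
  peq [:: A; B] ([:: A; base (up A)] ++
    (if beyond false A B then [:: gate false]
     else if beyond true A B then [:: gate true] else [::]) ++
    [:: base (up B); B]).
Proof.
move=> AB nU; have [Z [hZ AZ ZB] [yZ zP]] := crossing_point AB nU.
pose S := if beyond false A B then gate false
          else if beyond true A B then gate true else mid.
have yS : fy S = 0 by rewrite /S; case: ifP => _; [|case: ifP => _]; rewrite fy_mkpt.
have ZS : segment Z S `<=` N.
  apply: segN_side => g; have [zf bf] := zP false; have [zt bt] := zP true.
  have xE : dx true Z = 1 - dx false Z := dx_negb false Z.
  rewrite /S bf bt xE; rewrite xE in zt.
  case: (ltP (dx false Z) 0) => x0; last case: (ltP (1 - dx false Z) 0) => x1.
  - by rewrite dx_gate; case: g; rewrite ?xE /=; lra.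
  - by rewrite dx_gate; case: g; rewrite ?xE /=; lra.
  have {}x0 : 0 < dx false Z by rewrite lt_def zf.
  have {}x1 : 0 < 1 - dx false Z by rewrite lt_def zt.
  by rewrite dx_mid; case: g; rewrite ?xE; lra.
apply: (@peq_trans _ [:: A; base (up A); S; base (up B); B]).
  refine (peq_trans (peq_sym (peq_cancel hZ)) _).
  have hA := side_hull (wside_up A) (wside0 _ yZ) AZ.
  refine (peq_trans (peq_sym (peq_ctx [::] [:: B] (peq_cancel hA))) _).
  have hB := side_hull (wside0 _ yZ) (wside_up B) ZB.
  refine (peq_trans (peq_sym (peq_ctx [:: A; base (up A)] [::] (peq_cancel hB))) _).
  have hS b := side_hull (wside0 b yZ) (wside0 b yS) ZS.
  refine (peq_trans (peq_sym (peq_ctx [:: A] [:: base (up B); B]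
    (peq_cancel (hullNC (hS (up A)))))) _).
  refine (peq_trans (peq_ctx [:: A; base (up A)] [:: B]
    (peq_cancel (hullNC (hullNC (hS (up B)))))) _).
  exact: peq_refl.
rewrite /S; case: ifP => _; [exact: peq_refl | case: ifP => _; first exact: peq_refl].
refine (peq_ctx [:: A] [:: B] (peq_cancel
  (segN_hull (t := 2^-1) (@segN_base (up A) (up B)) _ _))).
  by apply/andP; split; lra.
apply: (@dx_inj false); rewrite ?dx_seg ?fy_seg ?dx_mid ?dx_base; first by lra.
by rewrite fy_mkpt !fy_base; case: (up A) (up B) nU => -[] // _; lra.
Qed.

Definition stem A : seq point := if up A then [::] else [:: d].

Definition loop (x : letter) : seq point :=
  if x.2 (+) x.1 then [:: gate x.1; d] else [:: d; gate x.1].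

Definition loops (w : seq letter) : seq point :=
  flatten [seq rcons (loop x) u | x <- w].

Lemma loops_cat w w' : loops (w ++ w') = loops w ++ loops w'.
Proof. by rewrite /loops map_cat flatten_cat. Qed.

Lemma last_loops w : last u (loops w) = u.
Proof.
by elim: w => //= x w IH; rewrite /loops /= last_cat last_rcons.
Qed.

Lemma belast_loops w : u :: loops w = rcons (belast u (loops w)) u.
Proof. by rewrite lastI last_loops. Qed.

Lemma segN_gate g b : segment (gate g) (base b) `<=` N.
Proof. exact: side_seg (wside0 b (fy_gate g)) (@N_gate g). Qed.

Lemma peq_base b : peq [:: base b] [:: base b; base (~~ b); base b].
Proof. exact: peq_sym (peq_back (@segN_base b (~~ b))). Qed.
Arguments peq_base b : clear implicits.

Lemma edge_arc A B : segment A B `<=` N ->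
  peq [:: A; B] (A :: stem A ++ (u :: loops (w0 A B)) ++ stem B ++ [:: B]).
Proof.
move=> AB; have [uE|nU] := eqVneq (up A) (up B).
  have -> : w0 A B = [::] by rewrite /w0 /beyond uE eqxx.
  have wB : wside (up A) B by rewrite uE; exact: wside_up.
  refine (peq_trans (peq_sym (peq_cancel (side_hull (wside_up A) wB AB))) _).
  rewrite /stem -uE; case: (up A) => /=; first exact: peq_refl.
  exact: (peq_ctx [:: A] [:: B] (peq_base false)).
refine (peq_trans (crossing_arc AB nU) _).
have := beyond_excl A B; rewrite /w0 /stem.
case: (beyond false A B); case: (beyond true A B) => //= _;
  case: (up A) (up B) nU => -[] //= _; rewrite /loops /loop /=; try exact: peq_refl.
- exact: (peq_ctx [:: A; u; gate false] [:: B] (peq_base false)).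
- exact: (peq_ctx [:: A] [:: gate false; u; B] (peq_base false)).
- exact: (peq_ctx [:: A; u; gate true] [:: B] (peq_base false)).
- exact: (peq_ctx [:: A] [:: gate true; u; B] (peq_base false)).
Qed.

Lemma stem_back A : N A -> peq (u :: stem A ++ A :: stem A ++ [:: u]) [:: u].
Proof.
move=> NA; have := segN_sym (side_seg (wside_up A) NA).
rewrite /stem; case: (up A) => /= uA; first exact: peq_back.
refine (peq_trans (peq_ctx [:: u] [:: u] (peq_back uA)) _).
exact: peq_sym (peq_base true).
Qed.

Lemma stem_forth A : N A -> peq [:: A] (A :: stem A ++ u :: stem A ++ [:: A]).
Proof.
move=> NA; have := side_seg (wside_up A) NA.
rewrite /stem; case: (up A) => /= Au; first exact: peq_sym (peq_back Au).
refine (peq_trans (peq_sym (peq_back Au)) _).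
exact: (peq_ctx [:: A] [:: A] (peq_base false)).
Qed.

Lemma arc_loops A s : N A ->
  (forall e, e \in consec A s -> segment e.1 e.2 `<=` N) ->
  peq (A :: s) (A :: stem A ++ (u :: loops (eword w0 (consec A s))) ++
                stem (last A s) ++ [:: last A s]).
Proof.
elim: s A => [|B s IH] A NA H; first exact: stem_forth.
have AB : segment A B `<=` N by apply: (H (A, B)); rewrite /= mem_head.
have NB : N B.
  by apply: AB; exists 1; rewrite ?lexx ?ler01 // /seg_pt subrr scale0r scale1r add0r.
have HB e : e \in consec B s -> segment e.1 e.2 `<=` N.
  by move=> es; apply: H; rewrite /= inE es orbT.
have {}IH := peq_ctx [:: A] [::] (IH B NB HB).
rewrite !cats0 /= in IH; refine (peq_trans IH _).
refine (peq_trans (peq_ctx [::] _ (edge_arc AB)) _) => /=.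
rewrite -[eword _ (_ :: _)]/(w0 A B ++ eword w0 (consec B s)) loops_cat.
set L := loops (w0 A B); set L' := loops (eword _ _).
set rest := stem (last B s) ++ [:: _].
pose L0 := belast u L.
have uL v : u :: L ++ v = L0 ++ [:: u] ++ v.
  by rewrite -cat_cons belast_loops -cats1 -catA.
have := peq_ctx (A :: stem A ++ L0) (L' ++ rest) (stem_back NB).
by rewrite /= -!catA /= -!catA !uL.
Qed.

Lemma segN_closed A s : closed_polyline N (cyc (A :: s)) ->
  N A /\ forall e, e \in consec A (rcons s A) -> segment e.1 e.2 `<=` N.
Proof.
move=> /closed_polyline_cyc[_]; rewrite edges_cons => H; split=> //.
have [B AB] : exists B, segment A B `<=` N.
  case: s H => [|B s] H; [exists A | exists B].
    by apply: (H (A, A)); rewrite /= mem_head.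
  by apply: (H (A, B)); rewrite /= mem_head.
by apply: AB; exists 0; rewrite ?lexx ?ler01 // /seg_pt subr0 scale0r scale1r addr0.
Qed.

(** * Standard lines *)

Definition std_line (w : seq letter) : polyline R := cyc (u :: loops w).

Lemma std_line_closed w : closed_polyline N (std_line w).
Proof.
apply/closed_polyline_cyc; split=> // e.
rewrite edges_cons -cats1 consec_cat last_loops mem_cat mem_seq1.
case/orP=> [|/eqP -> /=]; last exact: segN_base.
elim: w => [//|x w IH]; rewrite /loops /= consec_cat last_rcons mem_cat.
case/orP; last exact: IH.
have gb b := @segN_gate x.1 b; have bg b := segN_sym (gb b).
rewrite /loop; case: ifP => _ /=; rewrite !inE => /or3P[] /eqP -> //=; exact: segN_base.
Qed.

Lemma w0_base_gate g b :
  w0 (gate g) (base b) = if b then [::] else [:: (g, ~~ g)].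
Proof.
rewrite /w0 /beyond up_gate up_base /det !dx_base !dx_gate fy_gate fy_base.
by case: b => //=; case: g => /=; do 2?[case: ifP => // ?]; exfalso; lra.
Qed.

Lemma w0_gate_base g b :
  w0 (base b) (gate g) = if b then [::] else [:: (g, g)].
Proof.
rewrite /w0 /beyond up_gate up_base /det !dx_base !dx_gate fy_gate fy_base.
by case: b => //=; case: g => /=; do 2?[case: ifP => // ?]; exfalso; lra.
Qed.

Lemma w0_base b b' : w0 (base b) (base b') = [::].
Proof.
rewrite /w0 /beyond !up_base /det !dx_base !fy_base.
by case: b; case: b' => //=; do 2?[case: ifP => // ?]; exfalso; lra.
Qed.

Lemma std_line_word w : line_word (std_line w) = cyc w.
Proof.
rewrite /line_word /std_line cyc_eword_repr edges_cons -cats1 consec_cat last_loops.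
rewrite eword_cat /= /eword /= w0_base !cats0; congr cyc.
elim: w => [//|x w IH]; rewrite {1}/loops /= consec_cat last_rcons.
rewrite map_cat flatten_cat IH.
rewrite /loop; case: x => g []; case: g => /=;
  by rewrite ?w0_base_gate ?w0_gate_base ?w0_base.
Qed.

Lemma homotopic_std s : closed_polyline N (cyc s) ->
  homotopic N (cyc s) (std_line (eword w0 (edges s))).
Proof.
case: s => [/closed_polyline_cyc[]//|A s] Ns.
have [NA H] := segN_closed Ns.
have h0 : homotopic N (cyc (A :: s)) (cyc (A :: rcons s A)).
  rewrite -rcons_cons cyc_rcons.
  by apply: (peq_sym (@peq_dup A) (r := s)); left.
have [_ Nc] := homotopic_closed h0.
have h1 := peq_line (arc_loops NA H) (or_introl Nc).
refine (homotopic_trans h0 (homotopic_trans h1 _)).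
have [_ {}Nc] := homotopic_closed h1.
move: Nc {h1}; rewrite -edges_cons last_rcons; set L := loops _ => Nc.
have h2 := peq_line (peq_ctx (A :: stem A) (L ++ stem A ++ [:: A])
  (peq_sym (@peq_dup u))) (or_introl Nc).
refine (homotopic_trans h2 _).
have [_ {}Nc] := homotopic_closed h2.
have E : cyc ((A :: stem A) ++ [:: u; u] ++ L ++ stem A ++ [:: A]) =
    cyc (belast u L ++ (u :: stem A ++ [:: A] ++ A :: stem A ++ [:: u])).
  transitivity (cyc ((A :: stem A ++ [:: u]) ++ (u :: L ++ stem A ++ [:: A]))).
    by rewrite /= -!catA.
  by rewrite cyc_catC -cat_cons belast_loops -cats1 /= -!catA /= -?catA.
rewrite E in Nc *.
have h3 := peq_line (peq_ctx (belast u L ++ u :: stem A) (stem A ++ [:: u])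
  (@peq_dup A)).
rewrite /= -?catA /= -?catA /= in h3.
refine (homotopic_trans (h3 (or_introl Nc)) _).
have [_ {}Nc] := homotopic_closed (h3 (or_introl Nc)).
have h4 := peq_line (peq_ctx (belast u L) [::] (stem_back NA)).
have uL : u :: L = rcons (belast u L) u by exact: belast_loops.
rewrite /= cats0 (cats1 (belast u L)) -uL in h4; rewrite /std_line -/L.
exact: h4 (or_introl Nc).
Qed.

Lemma peq_loops w w' : peq (u :: loops (w ++ w')) ((u :: loops w) ++ (u :: loops w')).
Proof.
have := peq_ctx (belast u (loops w)) (loops w') (peq_sym (@peq_dup u)).
by rewrite loops_cat -cat_cons (belast_loops w) -cats1 -!catA.
Qed.

Lemma homotopic_std_rot w w' : homotopic N (std_line (w ++ w')) (std_line (w' ++ w)).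
Proof.
have h v v' := peq_line (@peq_loops v v') (or_introl (std_line_closed (v ++ v'))).
refine (homotopic_trans (h w w') _); rewrite cyc_catC; exact: homotopic_sym (h w' w).
Qed.

Lemma homotopic_std_cyc w w' : cyc w = cyc w' ->
  homotopic N (std_line w) (std_line w').
Proof.
by case/cycP=> k ->; rewrite -{1}(cat_take_drop k w); exact: homotopic_std_rot.
Qed.

Lemma peq_loop_cancel x : peq (u :: loops [:: x; letter_inv x]) [:: u].
Proof.
have gd g : segment d (gate g) `<=` N := segN_sym (@segN_gate g false).
rewrite /loops /loop /=; case: x => g s; rewrite /= addNb; case: (s (+) g) => /=.
  refine (peq_trans (peq_ctx [:: u; gate g] [:: gate g; u]
    (peq_sym (peq_base false))) _).
  refine (peq_trans (peq_ctx [:: u] [:: u] (peq_back (@segN_gate g false))) _).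
  exact: peq_back (segN_sym (@segN_gate g true)).
refine (peq_trans (peq_ctx [:: u; d] [:: d; u] (peq_back (@segN_gate g true))) _).
refine (peq_trans (peq_ctx [:: u] [:: u] (peq_back (gd g))) _).
exact: peq_sym (peq_base true).
Qed.

Lemma homotopic_std_cancel x w :
  homotopic N (std_line [:: x, letter_inv x & w]) (std_line w).
Proof.
apply: peq_line; last by right; exact: std_line_closed.
refine (peq_trans (@peq_loops [:: x; letter_inv x] w) _).
refine (peq_trans (peq_ctx [::] (u :: loops w) (@peq_loop_cancel x)) _).
exact: (peq_ctx [::] (loops w) (@peq_dup u)).
Qed.

Lemma homotopic_std_econ c v : economical_form c v ->
  homotopic N (std_line (repr c)) (std_line (repr v)).
Proof.
have reprE w : homotopic N (std_line (repr (cyc w))) (std_line w).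
  by apply: homotopic_std_cyc; rewrite /cyc reprK.
case=> + _; elim=> [_ _ [x [s [-> ->]]]|b|a b e _ ab _ be].
- refine (homotopic_trans (@reprE _) (homotopic_trans _ (homotopic_sym (@reprE _)))).
  exact: homotopic_std_cancel.
- exact/homotopic_refl/std_line_closed.
- exact: homotopic_trans ab be.
Qed.

Lemma homotopic_econ l l' : closed_polyline N l -> closed_polyline N l' ->
  econ (line_word l) = econ (line_word l') -> homotopic N l l'.
Proof.
have [s ->] := cycE l; have [s' ->] := cycE l'; move=> Nl Nl' E.
have [v vl] := economical_form_exists (line_word (cyc s)).
have vl' : economical_form (line_word (cyc s')) v by have : econ _ v := vl; rewrite E.
have std t : closed_polyline N (cyc t) -> economical_form (line_word (cyc t)) v ->
    homotopic N (cyc t) (std_line (repr v)).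
  move=> Nt tv; refine (homotopic_trans (homotopic_std Nt) _).
  refine (homotopic_trans _ (homotopic_std_econ tv)).
  by apply: homotopic_std_cyc; rewrite /line_word cyc_eword_repr /cyc reprK.
exact: homotopic_trans (std s Nl vl) (homotopic_sym (std s' Nl' vl')).
Qed.

(** * Comparison with an arbitrary pair of rays *)

Definition rdet g C X : R := dx g C * fy X - fy C * dx g X.

Definition rup C : bool := 0 < fy C.

(* The part of the half-plane containing the ray that lies between the ray and
   the half-line of points beyond the puncture. *)
Definition pocket g C X : bool :=
  if rup C then up X && (0 < rdet g C X) else ~~ up X && (rdet g C X < 0).

Lemma hitsE g C A B t : hits (pt g) C A B t <-> 0 <= t <= 1 /\
  exists2 s : R, 0 <= s & (1 - t) * dx g A + t * dx g B = s * dx g C /\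
                          (1 - t) * fy A + t * fy B = s * fy C.
Proof.
rewrite /hits /=; split=> -[t01].
  by move=> /rayE; rewrite dx_seg fy_seg.
by rewrite -dx_seg -fy_seg => /rayE.
Qed.

Lemma ray_collinear g C X : C != pt g -> ~ ray (pt g) C X -> rdet g C X = 0 ->
  dx g C * dx g X + fy C * fy X < 0.
Proof.
move=> nC nX c0; rewrite ltNge; apply/negP => dot; apply/nX/rayE.
have n0 : dx g C ^+ 2 + fy C ^+ 2 != 0.
  rewrite paddr_eq0 ?sqr_ge0 // !sqrf_eq0; apply: contra nC => /andP[/eqP x0 /eqP y0].
  by apply/eqP/eq_pt.
exists ((dx g C * dx g X + fy C * fy X) / (dx g C ^+ 2 + fy C ^+ 2)).
  by rewrite divr_ge0 // addr_ge0 ?sqr_ge0.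
have {}c0 : dx g C * fy X = fy C * dx g X by move: c0; rewrite /rdet; lra.
split; apply: (mulIf n0); rewrite [RHS]mulrAC divfK //.
  have -> : dx g X * (dx g C ^+ 2 + fy C ^+ 2) =
    dx g C * dx g X * dx g C + fy C * (fy C * dx g X) by ring.
  by rewrite -c0; ring.
have -> : fy X * (dx g C ^+ 2 + fy C ^+ 2) =
  dx g C * (dx g C * fy X) + fy C * fy X * fy C by ring.
by rewrite c0; ring.
Qed.

Lemma hit_facts g C A B t : C != pt g -> segment A B `<=` N ->
  ~ ray (pt g) C A -> ~ ray (pt g) C B -> hits (pt g) C A B t ->
  [/\ 0 < t < 1, rdet g C A * rdet g C B < 0, rdet g C A * det g A B < 0,
      (1 - t) * rdet g C A + t * rdet g C B = 0 &
      exists2 s : R, 0 < s & (1 - t) * dx g A + t * dx g B = s * dx g C /\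
                             (1 - t) * fy A + t * fy B = s * fy C].
Proof.
move=> nC AB nA nB /hitsE[/andP[t0 t1] [s s0 [xE yE]]].
have {t0}t0 : 0 < t.
  rewrite lt_def t0 andbT; apply/eqP => tE; apply: nA; apply/rayE; exists s => //.
  by move: xE yE; rewrite tE subr0 !mul1r !mul0r !addr0.
have {t1}t1 : t < 1.
  rewrite lt_def t1 andbT; apply/eqP => tE; apply: nB; apply/rayE; exists s => //.
  by move: xE yE; rewrite -tE subrr !mul1r !mul0r !add0r.
have {s0}s0 : 0 < s.
  rewrite lt_def s0 andbT; apply/eqP => sE; move: AB => /segN/(_ g)/(_ (1 - t) t).
  by apply; rewrite ?xE ?yE ?sE ?mul0r //; lra.
have cE : (1 - t) * rdet g C A + t * rdet g C B = 0.
  have -> : (1 - t) * rdet g C A + t * rdet g C B =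
    dx g C * ((1 - t) * fy A + t * fy B) - fy C * ((1 - t) * dx g A + t * dx g B).
    by rewrite /rdet; ring.
  by rewrite xE yE; ring.
have tdet : t * det g A B = - s * rdet g C A.
  have -> : t * det g A B = dx g A * ((1 - t) * fy A + t * fy B) -
                            fy A * ((1 - t) * dx g A + t * dx g B).
    by rewrite /det; ring.
  by rewrite xE yE /rdet; ring.
have cA0 : rdet g C A != 0.
  apply/eqP => cA0; have cB0 : rdet g C B = 0.
    by apply/eqP; move/eqP: cE; rewrite cA0 mulr0 add0r mulf_eq0 (gt_eqF t0).
  have dA := ray_collinear nC nA cA0; have dB := ray_collinear nC nB cB0.
  have : (1 - t) * (dx g C * dx g A + fy C * fy A) +
         t * (dx g C * dx g B + fy C * fy B) = s * (dx g C ^+ 2 + fy C ^+ 2).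
    have -> : s * (dx g C ^+ 2 + fy C ^+ 2) = dx g C * (s * dx g C) + fy C * (s * fy C).
      by ring.
    by rewrite -xE -yE; ring.
  have : 0 <= s * (dx g C ^+ 2 + fy C ^+ 2).
    by rewrite mulr_ge0 ?(ltW s0) // addr_ge0 ?sqr_ge0.
  have : t * (dx g C * dx g B + fy C * fy B) < 0 by rewrite pmulr_rlt0.
  have : (1 - t) * (dx g C * dx g A + fy C * fy A) < 0 by rewrite pmulr_rlt0 ?subr_gt0.
  lra.
have sq : 0 < rdet g C A ^+ 2 by rewrite exprn_even_gt0.
split; [by rewrite t0 | | | by [] | by exists s].
  rewrite -(pmulr_rlt0 _ t0).
  have -> : t * (rdet g C A * rdet g C B) = - ((1 - t) * rdet g C A ^+ 2).
    have -> : t * (rdet g C A * rdet g C B) = rdet g C A * (t * rdet g C B) by ring.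
    by rewrite (_ : t * rdet g C B = - ((1 - t) * rdet g C A)); [ring | lra].
  by rewrite oppr_lt0 mulr_gt0 ?subr_gt0.
rewrite -(pmulr_rlt0 _ t0) mulrCA tdet mulrCA -expr2 mulNr oppr_lt0.
exact: mulr_gt0.
Qed.

Lemma hit_exists g C A B : rdet g C A * rdet g C B < 0 ->
  rdet g C A * det g A B < 0 -> hits (pt g) C A B !=set0.
Proof.
set a := rdet g C A; set b := rdet g C B; set e := det g A B => ab ae.
have id1 : - b * dx g A + a * dx g B = - e * dx g C.
  by rewrite /a /b /e /rdet /det; ring.
have id2 : - b * fy A + a * fy B = - e * fy C.
  by rewrite /a /b /e /rdet /det; ring.
have n0 : a - b != 0 by apply/eqP => h; move: ab; nra.
exists (a / (a - b)); apply/hitsE; split.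
  move: ab ae; case: (ltrgt0P a) => a0; last by rewrite a0 mul0r ltxx.
    rewrite pmulr_rlt0 // => b0 _; apply/andP; split; first by apply: divr_ge0; lra.
    by rewrite ler_pdivrMr ?mul1r; lra.
  rewrite nmulr_rlt0 // => b0 _; rewrite -mulrNN -invrN; apply/andP.
  split; first by apply: divr_ge0; lra.
  by rewrite ler_pdivrMr ?mul1r; lra.
exists (- e / (a - b)).
  move: ab ae; case: (ltrgt0P a) => a0; last by rewrite a0 mul0r ltxx.
    by rewrite !pmulr_rlt0 // => b0 e0; apply: divr_ge0; lra.
  by rewrite !nmulr_rlt0 // => b0 e0; rewrite -mulrNN -invrN; apply: divr_ge0; lra.
have -> : 1 - a / (a - b) = - b / (a - b) by field.
split.
  transitivity ((- b * dx g A + a * dx g B) / (a - b)); first by field.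
  by rewrite id1; field.
transitivity ((- b * fy A + a * fy B) / (a - b)); first by field.
by rewrite id2; field.
Qed.

Lemma ray_wordE g C A B : C != pt g -> segment A B `<=` N ->
  ~ ray (pt g) C A -> ~ ray (pt g) C B ->
  ray_word g (pt g) C A B =
  if (rdet g C A * rdet g C B < 0) && (rdet g C A * det g A B < 0)
  then [:: (g, (0 < det g A B) (+) g)] else [::].
Proof.
move=> nC AB nA nB; rewrite /ray_word.
have -> : `[< hits (pt g) C A B !=set0 >] =
    (rdet g C A * rdet g C B < 0) && (rdet g C A * det g A B < 0).
  apply/asboolP/andP => [[t /(hit_facts nC AB nA nB)[]]|[]] //.
  exact: hit_exists.
case: ifP => // /andP[_ e0]; congr [:: (_, _)]; rewrite clockwise_det.
have {e0} : det g A B != 0 by apply: contraTneq e0 => ->; rewrite mulr0 ltxx.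
by move: (det g A B) => e; case: (g); rewrite ?addbT ?addbF // -leNgt lt_def => ->.
Qed.

Lemma pocket_rule (g : bool) (p yA yB cA cB e : R) :
  p != 0 -> p * e = yA * cB - yB * cA ->
  ((0 < p) = (0 <= yA) -> cA != 0) -> ((0 < p) = (0 <= yB) -> cB != 0) ->
  ((0 <= yA) != (0 <= yB) -> e != 0) -> (cA * cB < 0 -> e != 0) ->
  let pk y c := if 0 < p then (0 <= y) && (0 < c) else ~~ (0 <= y) && (c < 0) in
  (if (cA * cB < 0) && (cA * e < 0) then [:: (g, (0 < e) (+) g)] else [::]) =
  red ((if pk yA cA then [:: (g, ~~ (0 < p) (+) g)] else [::]) ++
       (if ((0 <= yA) != (0 <= yB)) && (if 0 <= yA then 0 < e else e < 0)
        then [:: (g, (0 <= yA) (+) g)] else [::]) ++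
       winv (if pk yB cB then [:: (g, ~~ (0 < p) (+) g)] else [::])).
Proof.
move=> p0 idE hA hB he he' /=.
have sgn (x y : R) : (x * y < 0) = (x < 0) && (0 < y) || (0 < x) && (y < 0).
  case: (ltrgt0P x) => x0; last by rewrite x0 mul0r ltxx.
  - by rewrite pmulr_rlt0 //= ?orbF.
  - by rewrite nmulr_rlt0 //= ?orbF.
rewrite !sgn; move: hA hB he he'; rewrite sgn.
case: (ltrgt0P p) p0 => // p0 _;
case: (ltrgt0P cA) => cA0; case: (ltrgt0P cB) => cB0; case: (ltrgt0P e) => e0;
case: (leP 0 yA) => yA0; case: (leP 0 yB) => yB0 //= hA hB he he';
do ?[by have := hA erefl | by have := hB erefl | by have := he isT
    | by have := he' isT];
first [by case: g | exfalso; nra].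
Qed.

Definition pocket_letter g C X : seq letter :=
  if pocket g C X then [:: (g, ~~ rup C (+) g)] else [::].

Definition beyond_letter g A B : seq letter :=
  if beyond g A B then [:: (g, up A (+) g)] else [::].

Lemma w0E A B : w0 A B = beyond_letter false A B ++ beyond_letter true A B.
Proof. by rewrite /w0 /beyond_letter addbF addbT. Qed.

Lemma ray_on_axis g C X : fy C = 0 -> dx g C < 0 -> ~ ray (pt g) C X ->
  fy X = 0 -> 0 < dx g X.
Proof.
move=> yC xC nX yX; rewrite ltNge; apply/negP => x0; apply/nX/rayE.
exists (dx g X / dx g C); first by rewrite -mulrNN -invrN divr_ge0; lra.
by rewrite yC yX mulr0 divfK // lt_eqF.
Qed.

Lemma ray_word_pocket g C A B : C != pt g -> (fy C = 0 -> dx g C < 0) ->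
  segment A B `<=` N -> ~ ray (pt g) C A -> ~ ray (pt g) C B ->
  ray_word g (pt g) C A B =
  red (pocket_letter g C A ++ beyond_letter g A B ++ winv (pocket_letter g C B)).
Proof.
move=> nC xC AB nA nB; rewrite ray_wordE //.
have [yC|yC] := eqVneq (fy C) 0.
  have {}xC := xC yC.
  have hA := ray_on_axis yC xC nA; have hB := ray_on_axis yC xC nB.
  have cE X : rdet g C X = dx g C * fy X by rewrite /rdet yC mul0r subr0.
  have lE X : pocket_letter g C X = [::].
    rewrite /pocket_letter /pocket /rup /up yC ltxx cE nmulr_rlt0 //.
    by case: (ltrgt0P (fy X)).
  rewrite !lE /= cats0 /beyond_letter /beyond !cE.
  have -> : dx g C * fy A * (dx g C * fy B) = dx g C ^+ 2 * (fy A * fy B) by ring.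
  have c2 : 0 < dx g C ^+ 2 by rewrite exprn_even_gt0 //= lt_eqF.
  rewrite (pmulr_rlt0 _ c2) -mulrA (nmulr_rlt0 _ xC).
  have := det_neq0 g AB; rewrite /up; move: hA hB; rewrite /det.
  case: (ltrgt0P (fy A)) => yA; case: (ltrgt0P (fy B)) => yB hA hB /=;
    rewrite ?yA ?yB ?mulr0 ?mul0r ?ltxx ?subr0 ?sub0r //=.
  - by rewrite ltNge mulr_ge0 ?ltW.
  - rewrite (pmulr_rlt0 _ yA) yB (pmulr_rgt0 _ yA) => /(_ isT).
    by case: (ltrgt0P (_ - _)).
  - rewrite (nmulr_rlt0 _ yA) yB (nmulr_rgt0 _ yA) => /(_ isT).
    by case: (ltrgt0P (_ - _)).
  - by rewrite ltNge mulr_le0 ?ltW.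
  - by move=> _; rewrite oppr_lt0 (nmulr_lgt0 _ yA) ltNge (ltW (hB yB)).
  - by move=> _; rewrite (nmulr_lgt0 _ yB) ltNge (ltW (hA yA)).
have nz X : ~ ray (pt g) C X -> (0 < fy C) = (0 <= fy X) -> rdet g C X != 0.
  move=> nX yE; apply/eqP => c0; have := ray_collinear nC nX c0.
  have : (dx g C * dx g X + fy C * fy X) * fy C = (dx g C ^+ 2 + fy C ^+ 2) * fy X.
    have {}c0 : fy C * dx g X = dx g C * fy X by move: c0; rewrite /rdet; lra.
    have -> : (dx g C * dx g X + fy C * fy X) * fy C =
      dx g C * (fy C * dx g X) + fy C * fy X * fy C by ring.
    by rewrite c0; ring.
  have n0 : 0 < dx g C ^+ 2 + fy C ^+ 2.
    by rewrite ltr_wpDl ?sqr_ge0 // exprn_even_gt0.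
  move: yE; case: (ltrgt0P (fy C)) yC => // yC _; case: (leP 0 (fy X)) => // yX _ E dot.
    by have := mulr_ge0 (ltW n0) yX; rewrite -E (pmulr_lge0 _ yC) leNgt dot.
  by have := pmulr_rlt0 (fy X) n0; rewrite -E yX (nmulr_llt0 _ yC) ltNge (ltW dot).
apply: (pocket_rule g yC).
- by rewrite /rdet /det; ring.
- exact: nz.
- exact: nz.
- exact: det_neq0.
move=> cc; apply/eqP => e0; move: AB => /segN/(_ g) H.
have id1 : - rdet g C B * dx g A + rdet g C A * dx g B = - det g A B * dx g C.
  by rewrite /rdet /det; ring.
have id2 : - rdet g C B * fy A + rdet g C A * fy B = - det g A B * fy C.
  by rewrite /rdet /det; ring.
rewrite e0 oppr0 !mul0r in id1 id2.
move: cc; case: (ltrgt0P (rdet g C A)) => cA; last by rewrite cA mul0r ltxx.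
  by rewrite pmulr_rlt0 // => cB; apply: (H _ _ _ _ _ id1 id2); lra.
rewrite nmulr_rlt0 // => cB.
by apply: (H (rdet g C B) (- rdet g C A)); lra.
Qed.

(** * Disjoint rays *)

Definition disjoint_rays C D : Prop := ray P C `&` ray Q D = set0.

Lemma disjoint_raysP C D : disjoint_rays C D -> forall s t : R, 0 <= s -> 0 <= t ->
  s * dx false C = 1 - t * dx true D -> s * fy C = t * fy D -> False.
Proof.
move=> /seteqP[H _] s t s0 t0 xE yE.
apply: (H (mkpt (s * dx false C) (s * fy C))); split.
  by apply/(@rayE false); exists s => //; rewrite /dx fx_mkpt fy_mkpt.
apply/(@rayE true); exists t => //; rewrite [dx true (mkpt _ _)]/dx fx_mkpt fy_mkpt.
by rewrite xE; split=> //; ring.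
Qed.

Lemma disjoint_rays_axis C D : C != P -> D != Q -> disjoint_rays C D ->
  (fy C = 0 -> dx false C < 0) /\ (fy D = 0 -> dx true D < 0).
Proof.
move=> nC nD /disjoint_raysP H; split=> y0; rewrite ltNge; apply/negP => x0.
  have {x0}x0 : 0 < dx false C.
    rewrite lt_def x0 andbT; apply: contra nC => /eqP x1.
    by apply/eqP/(eq_pt false).
  apply: (H (dx false C)^-1 0) => //; rewrite ?invr_ge0 ?(ltW x0) //.
    by rewrite mul0r subr0 mulVf // gt_eqF.
  by rewrite y0 mulr0 mul0r.
have {x0}x0 : 0 < dx true D.
  rewrite lt_def x0 andbT; apply: contra nD => /eqP x1.
  by apply/eqP/(eq_pt true).
apply: (H 0 (dx true D)^-1) => //; rewrite ?invr_ge0 ?(ltW x0) //.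
  by rewrite mul0r mulVf ?subrr // gt_eqF.
by rewrite y0 mulr0 mul0r.
Qed.

(* [k] is the cross product of the directions of the rays, as [dx true] reverses
   the abscissa. *)
Lemma disjoint_rays_diverge C D : disjoint_rays C D ->
  let k := dx false C * fy D + fy C * dx true D in
  (0 < fy C -> 0 < fy D -> k <= 0) /\ (fy C <= 0 -> fy D <= 0 -> 0 <= k).
Proof.
move=> /disjoint_raysP H k; have meet : 0 <= fy D / k -> 0 <= fy C / k -> k = 0.
  move=> D0 C0; apply/eqP; apply: contraT => k0; exfalso.
  apply: (H _ _ D0 C0); last by field.
  by rewrite /k in k0 *; field.
split=> C0 D0.
  rewrite leNgt; apply/negP => k0.
  have := meet (divr_ge0 (ltW D0) (ltW k0)) (divr_ge0 (ltW C0) (ltW k0)); lra.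
rewrite leNgt; apply/negP => k0; have ik : k^-1 <= 0 by rewrite invr_le0 ltW.
have := meet (mulr_le0 D0 ik) (mulr_le0 C0 ik); lra.
Qed.

Lemma pocket_excl C D X : C != P -> D != Q -> disjoint_rays C D ->
  ~~ (pocket false C X && pocket true D X).
Proof.
move=> nC nD CD; have [xC xD] := disjoint_rays_axis nC nD CD.
have [k1 k2] := disjoint_rays_diverge CD.
rewrite /pocket /rup /rdet (dx_negb false X) /up.
set k := _ + _ in k1 k2.
have id : fy D * (dx false C * fy X - fy C * dx false X) +
  fy C * (dx true D * fy X - fy D * (1 - dx false X)) = fy X * k - fy C * fy D.
  by rewrite /k; ring.
apply/negP; move: xC xD.
case: (ltrgt0P (fy C)) k1 k2 => yC k1 k2;
  case: (ltrgt0P (fy D)) k1 k2 => yD k1 k2 xC xD;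
  case: (leP 0 (fy X)) => yX /=; rewrite ?andbF // => /andP[a b].
- have := k1 isT isT; nra.
- have := k2 isT isT; nra.
- have := xD yD; move: b; rewrite yD mul0r subr0; nra.
- have := xC yC; move: a; rewrite yC mul0r subr0; nra.
- have := xC yC; move: a; rewrite yC mul0r subr0; nra.
Qed.

Lemma order_rule (rP rQ uA uB pA pB qA qB bP bQ o : bool) :
  pA ==> (rP == uA) -> pB ==> (rP == uB) -> qA ==> (rQ == uA) -> qB ==> (rQ == uB) ->
  (bP || bQ) ==> (uA != uB) ->
  ~~ (bP && bQ) -> ~~ (pA && qA) -> ~~ (pB && qB) ->
  let letter_if (b : bool) x : seq letter := if b then [:: x] else [::] in
  let wP := red (letter_if pA (false, ~~ rP) ++ letter_if bP (false, uA) ++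
                 winv (letter_if pB (false, ~~ rP))) in
  let wQ := red (letter_if qA (true, rQ) ++ letter_if bQ (true, ~~ uA) ++
                 winv (letter_if qB (true, rQ))) in
  (wP != [::] -> wQ != [::] -> (rP == rQ) || (uA != uB) ->
     o = if rP == rQ then wP == [:: (false, rP)] else uA != rP) ->
  red (if o then wQ ++ wP else wP ++ wQ) =
  red ((letter_if pA (false, ~~ rP) ++ letter_if qA (true, rQ)) ++
       (letter_if bP (false, uA) ++ letter_if bQ (true, ~~ uA)) ++
       winv (letter_if pB (false, ~~ rP) ++ letter_if qB (true, rQ))).
Proof.
case: rP; case: rQ; case: uA; case: uB; case: pA => //; case: pB => //;
case: qA => //; case: qB => //; case: bP => //; case: bQ => //=;
move=> _ _ _ _ _ _ _ _; rewrite /red /winv /=; case: o => //;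
by move/(_ isT isT isT).
Qed.

Lemma crossing_order C D A B : C != P -> D != Q -> disjoint_rays C D ->
  segment A B `<=` N ->
  ~ ray P C A -> ~ ray P C B -> ~ ray Q D A -> ~ ray Q D B ->
  hits P C A B !=set0 -> hits Q D A B !=set0 ->
  (rup C == rup D) || (up A != up B) ->
  `[< exists t v, [/\ hits P C A B t, hits Q D A B v & v < t] >] =
  if rup C == rup D then (rdet false C A < 0) == rup C else up A != rup C.
Proof.
move=> nC nD CD AB PA PB QA QB [t ht] [v hv] same.
have := @hit_facts false C A B; rewrite /= => /(_ _ nC AB PA PB) Pf.
have := @hit_facts true D A B; rewrite /= => /(_ _ nD AB QA QB) Qf.
have [/andP[t0 t1] cAB _ ct [s s0 [sx sy]]] := Pf t ht.
have [/andP[v0 v1] dAB _ dv [s' s'0 [sx' sy']]] := Qf v hv.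
have cn : rdet false C A - rdet false C B != 0.
  by apply/eqP => E; move: cAB; rewrite (_ : rdet false C B = rdet false C A);
     [rewrite ltNge -expr2 sqr_ge0 | lra].
have dn : rdet true D A - rdet true D B != 0.
  by apply/eqP => E; move: dAB; rewrite (_ : rdet true D B = rdet true D A);
     [rewrite ltNge -expr2 sqr_ge0 | lra].
have -> : `[< exists t v, [/\ hits P C A B t, hits Q D A B v & v < t] >] = (v < t).
  apply/asboolP/idP => [[t' [v' [ht' hv' lt]]]|lt]; last by exists t, v.
  have [_ _ _ ct' _] := Pf t' ht'; have [_ _ _ dv' _] := Qf v' hv'.
  have -> : t = t' by apply: (mulIf cn); lra.
  by have -> : v = v' by apply: (mulIf dn); lra.
have tv : t != v.
  apply/eqP => tv; apply: (disjoint_raysP CD (ltW s0) (ltW s'0)).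
    by rewrite -sx -sx' tv (dx_negb false A) (dx_negb false B); ring.
  by rewrite -sy -sy' tv.
have [xC xD] := disjoint_rays_axis nC nD CD.
have [k1 k2] := disjoint_rays_diverge CD.
have cv : (t - v) * (rdet false C A - rdet false C B) =
    s' * (dx false C * fy D + fy C * dx true D) - fy C.
  have -> : (t - v) * (rdet false C A - rdet false C B) =
    (1 - v) * rdet false C A + v * rdet false C B -
    ((1 - t) * rdet false C A + t * rdet false C B) by ring.
  have -> : (1 - v) * rdet false C A + v * rdet false C B =
    dx false C * ((1 - v) * fy A + v * fy B) -
    fy C * ((1 - v) * dx false A + v * dx false B) by rewrite /rdet; ring.
  have -> : (1 - v) * dx false A + v * dx false B = 1 - s' * dx true D.
    by rewrite -sx' (dx_negb false A) (dx_negb false B); ring.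
  by rewrite ct sy'; ring.
have yv : (t - v) * (fy B - fy A) = s * fy C - s' * fy D by rewrite -sy -sy'; ring.
have tv0 : t - v != 0 by rewrite subr_eq0.
have := mulf_neq0 tv0 cn; rewrite cv.
have -> : (v < t) = (0 < t - v) by rewrite subr_gt0.
move: same tv0 (conj k1 k2) cv yv cAB; rewrite /rup /up.
move: (t - v) (_ + fy C * _) (rdet false C A) (rdet false C B) => w k a b same tv0 Dk.
clear -s0 s'0 same tv0 Dk; move: same.
case: (ltP 0 (fy C)) Dk => yC [k1' k2']; case: (ltP 0 (fy D)) k1' k2' => yD k1' k2' /=.
- have sk := mulr_ge0_le0 (ltW s'0) (k1' isT isT).
  case: (ltrgt0P a) => a0 _ cv _ ab _; last by rewrite a0 mul0r ltxx in ab.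
    rewrite (pmulr_rlt0 _ a0) in ab; have c0 : 0 < a - b by lra.
    by case: (ltrgt0P w) tv0 => // w0 _; have := mulr_gt0 w0 c0; lra.
  rewrite (nmulr_rlt0 _ a0) in ab; have c0 : a - b < 0 by lra.
  by case: (ltrgt0P w) tv0 => // w0 _; have := nmulr_rgt0 (a - b) w0; rewrite c0; lra.
- have p1 := mulr_gt0 s0 yC; have p2 := mulr_ge0_le0 (ltW s'0) yD.
  case: (leP 0 (fy A)) => yA; case: (leP 0 (fy B)) => yB //= _ _ yv _ _;
    case: (ltrgt0P w) tv0 => // w0 _; exfalso.
    have : w * (fy B - fy A) < 0 by rewrite pmulr_rlt0 //; lra.
    lra.
  have : w * (fy B - fy A) < 0 by rewrite nmulr_rlt0 //; lra.
  lra.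
- have p1 := mulr_ge0_le0 (ltW s0) yC; have p2 := mulr_gt0 s'0 yD.
  case: (leP 0 (fy A)) => yA; case: (leP 0 (fy B)) => yB //= _ _ yv _ _;
    case: (ltrgt0P w) tv0 => // w0 _; exfalso.
    have : 0 < w * (fy B - fy A) by rewrite nmulr_rgt0 //; lra.
  lra.
  have : 0 < w * (fy B - fy A) by rewrite pmulr_rgt0 //; lra.
  lra.
- have sk := mulr_ge0 (ltW s'0) (k2' isT isT).
  case: (ltrgt0P a) => a0 _ cv _ ab _; last by rewrite a0 mul0r ltxx in ab.
    rewrite (pmulr_rlt0 _ a0) in ab; have c0 : 0 < a - b by lra.
    by case: (ltrgt0P w) tv0 => // w0 _; have := nmulr_rlt0 (a - b) w0; rewrite c0; lra.
  rewrite (nmulr_rlt0 _ a0) in ab; have c0 : a - b < 0 by lra.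
  by case: (ltrgt0P w) tv0 => // w0 _; have := pmulr_rlt0 (a - b) w0; rewrite c0; lra.
Qed.

Definition pocket_word C D X : seq letter :=
  pocket_letter false C X ++ pocket_letter true D X.

Definition off_rays C D X : Prop := ~ ray P C X /\ ~ ray Q D X.

Lemma pocket_side g C X : pocket g C X ==> (rup C == up X).
Proof. by rewrite /pocket; case: (rup C); case: (up X); rewrite ?implybT. Qed.

Lemma ray_word_hits g C C' A B : ray_word g C C' A B != [::] -> hits C C' A B !=set0.
Proof. by rewrite /ray_word; case: ifP => // /asboolP. Qed.

Lemma edge_word_pocket C D A B : C != P -> D != Q -> disjoint_rays C D ->
  segment A B `<=` N -> off_rays C D A -> off_rays C D B ->
  feq (edge_word P C Q D A B) (pocket_word C D A ++ w0 A B ++ winv (pocket_word C D B)).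
Proof.
move=> nC nD CD AB [PA QA] [PB QB]; apply: feq_of_red.
have [xC xD] := disjoint_rays_axis nC nD CD.
have wP := @ray_word_pocket false C A B nC xC AB PA PB.
have wQ := @ray_word_pocket true D A B nD xD AB QA QB.
have PE := @ray_wordE false C A B nC AB PA PB.
rewrite /= in wP wQ PE.
have oE := crossing_order nC nD CD AB PA PB QA QB.
rewrite /edge_word; set o := `[< _ >] in oE *.
have {oE} oE : ray_word false P C A B != [::] -> ray_word true Q D A B != [::] ->
    (rup C == rup D) || (up A != up B) ->
    o = if rup C == rup D then ray_word false P C A B == [:: (false, rup C)]
        else up A != rup C.
  move=> P0 Q0 same; rewrite (oE (ray_word_hits P0) (ray_word_hits Q0) same).
  case: ifP => // _; move: P0; rewrite PE.
  case: ifP => // /andP[_ ca] _; rewrite eqseq_cons andbT xpair_eqE /= addbF.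
  congr (_ == _); move: ca; case: (ltrgt0P (rdet false C A)) => c0;
    last by rewrite c0 mul0r ltxx.
    by rewrite (pmulr_rlt0 _ c0) => /lt_gtF.
  by rewrite (nmulr_rlt0 _ c0) => ->.
rewrite w0E /pocket_word; move: oE; rewrite wP wQ.
rewrite /pocket_letter /beyond_letter !addbF !addbT !negbK; apply: order_rule.
- exact: pocket_side.
- exact: pocket_side.
- exact: pocket_side.
- exact: pocket_side.
- by rewrite /beyond; case: (up A != up B); rewrite ?implybT.
- exact: beyond_excl.
- exact: pocket_excl.
- exact: pocket_excl.
Qed.

Lemma eword_pocket C D A s : C != P -> D != Q -> disjoint_rays C D ->
  (forall e, e \in consec A s -> segment e.1 e.2 `<=` N) ->
  (forall X, X \in A :: s -> off_rays C D X) ->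
  feq (eword (edge_word P C Q D) (consec A s))
      (pocket_word C D A ++ eword w0 (consec A s) ++ winv (pocket_word C D (last A s))).
Proof.
move=> nC nD CD; elim: s A => [|B s IH] A sN off /=.
  exact/feq_sym/feq_winvr.
have offA : off_rays C D A by apply: off; rewrite mem_head.
have offB : off_rays C D B by apply: off; rewrite !inE eqxx orbT.
have AB := edge_word_pocket nC nD CD (sN (A, B) (mem_head _ _)) offA offB.
have sN' e : e \in consec B s -> segment e.1 e.2 `<=` N.
  by move=> es; apply: sN; rewrite /= inE es orbT.
have off' X : X \in B :: s -> off_rays C D X.
  by move=> Xs; apply: off; rewrite inE Xs orbT.
have cancelB := feq_ctx (pocket_word C D A ++ w0 A B)
  (eword w0 (consec B s) ++ winv (pocket_word C D (last B s)))
  (feq_winvl (pocket_word C D B)).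
apply: feq_trans (feq_cat AB (IH B sN' off')) _.
by move: cancelB; rewrite /= -!catA.
Qed.

Lemma econ_poincare C D s : C != P -> D != Q -> disjoint_rays C D ->
  closed_polyline N (cyc s) -> (forall X, X \in s -> off_rays C D X) ->
  econ (poincare_word P C Q D (cyc s)) = econ (line_word (cyc s)).
Proof.
move=> nC nD CD; case: s => [/closed_polyline_cyc[]//|A s] Ns off.
have [_ sN] := segN_closed Ns.
rewrite poincare_word_cyc /line_word cyc_eword_repr edges_cons.
rewrite -[flatten _]/(eword (edge_word P C Q D) _).
have offs X : X \in A :: rcons s A -> off_rays C D X.
  by move=> Xs; apply: off; move: Xs; rewrite !inE mem_rcons inE orbA orbb.
rewrite (feq_cyc (eword_pocket nC nD CD sN offs)) last_rcons cyc_catC -catA.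
by have := feq_cat (feq_refl (eword w0 (consec A (rcons s A))))
  (feq_winvl (pocket_word C D A)); rewrite cats0 => /feq_cyc.
Qed.

Lemma seq_bound (s : seq R) : exists k : R, forall x, x \in s -> x < k.
Proof.
elim: s => [|x s [k IH]]; first by exists 0.
exists (Num.max k (x + 1)) => y; rewrite inE => /orP[/eqP ->|/IH yk].
  by rewrite lt_max ltrDl ltr01 orbT.
by rewrite lt_max yk.
Qed.

Lemma closed_vertices s A : closed_polyline N (cyc s) -> A \in s -> N A.
Proof.
move=> Ns /rot_to[i s' E]; have : cyc s = cyc (A :: s') by apply/cycP; exists i.
by move=> E'; rewrite E' in Ns; have [] := segN_closed Ns.
Qed.

Lemma admissible_rays_exist l : closed_polyline N l ->
  exists C D, admissible_rays P Q l C D.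
Proof.
have [s ->] := cycE l => Ns.
(* Both rays get the direction [(k, 1)], with [k] beyond the inverse slope of every
   vertex seen from either puncture. *)
have [k kP] := seq_bound ([seq fx X / fy X | X <- s] ++
                          [seq (fx X - 1) / fy X | X <- s]).
have off (X : point) : X \in s -> forall t : R, 0 <= t -> fy X = t ->
    fx X <> t * k /\ fx X <> 1 + t * k.
  move=> Xs t; rewrite le_eqVlt => /predU1P[<-|t0] yX.
    have /NP NX := closed_vertices Ns Xs.
    by rewrite !mul0r addr0; split=> xX; [apply: (NX false) | apply: (NX true)];
       apply/eq_pt; rewrite /dx xX ?subrr.
  have k1 : fx X / fy X < k.
    by apply: kP; rewrite mem_cat; apply/orP; left; exact: map_f.
  have k2 : (fx X - 1) / fy X < k.
    by apply: kP; rewrite mem_cat; apply/orP; right; apply: (map_f (fun X => _ / _)).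
  by split=> xX; [move: k1 | move: k2]; rewrite yX ltr_pdivrMr // xX; lra.
exists (mkpt k 1), (mkpt (1 + k) 1); split.
- by apply/eqP => /(eq_pt false)[_ /eqP]; rewrite fy_mkpt oner_eq0.
- by apply/eqP => /(eq_pt true)[_ /eqP]; rewrite fy_mkpt oner_eq0.
- apply/seteqP; split=> // X [/(@rayE false)[t t0 [xE yE]]].
  move=> /(@rayE true)[t' t0' [xE' yE']].
  by move: xE yE xE' yE'; rewrite /dx !fx_mkpt !fy_mkpt !mulr1 => -> ->; nra.
- apply/general_position_cyc => X Xs /(@rayE false)[t t0].
  rewrite /dx fx_mkpt fy_mkpt mulr1 => -[xE yE].
  by have [] := off X Xs t t0 yE.
- apply/general_position_cyc => X Xs /(@rayE true)[t t0].
  rewrite /dx fx_mkpt fy_mkpt mulr1 => -[xE yE].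
  by have [_ []] := off X Xs t t0 yE; lra.
Qed.

(** * The bijection *)

Definition class_word (S : set (polyline R)) : cword :=
  xget (cyc [::]) [set v | exists2 l, S l & economical_form (line_word l) v].

Lemma class_wordE l v : closed_polyline N l -> economical_form (line_word l) v ->
  class_word (homotopy_class N l) = v.
Proof.
move=> Nl lv; apply: xget_unique; first by exists l => //; exact: homotopic_refl.
move=> v' [l' /econ_homotopic E lv'].
have : econ (line_word l') v' by [].
by rewrite -E (econE lv).
Qed.

Lemma class_word_form l : closed_polyline N l ->
  economical_form (line_word l) (class_word (homotopy_class N l)).
Proof.
move=> Nl; have [v lv] := economical_form_exists (line_word l).
by rewrite (class_wordE Nl lv).
Qed.

Lemma poincare_class_word l C D v : closed_polyline N l -> admissible_rays P Q l C D ->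
  economical_form (poincare_word P C Q D l) v <-> v = class_word (homotopy_class N l).
Proof.
have [s ->] := cycE l => Ns [nC nD CD gC gD].
have off X : X \in s -> off_rays C D X.
  by move=> Xs; split; [move: X Xs | move: X Xs]; exact/general_position_cyc.
rewrite -[economical_form _ _]/(econ _ v) (econ_poincare nC nD CD Ns off).
by rewrite (econE (class_word_form Ns)).
Qed.

Lemma class_word_bij : set_bij (homotopy_classes N) economical_words class_word.
Proof.
split.
- by move=> _ [l Nl <-]; case: (class_word_form Nl).
- move=> _ _ /set_mem[l Nl <-] /set_mem[l' Nl' <-] E.
  have ll' : homotopic N l l'.
    apply: homotopic_econ => //.
    by rewrite (econE (class_word_form Nl)) (econE (class_word_form Nl')) E.
  apply/seteqP; split=> k kl; last exact: homotopic_trans ll' kl.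
  exact: homotopic_trans (homotopic_sym ll') kl.
- move=> v ev; exists (homotopy_class N (std_line (repr v))).
    by exists (std_line (repr v)) => //; exact: std_line_closed.
  apply: class_wordE; first exact: std_line_closed.
  by rewrite std_line_word /cyc reprK; split=> //; exact: rt_refl.
Qed.

End TwoPunctures.

Theorem proposition7p7 (R : realType) (P Q : 'rV[R]_2) (hPQ : P != Q) :
  let N : set 'rV[R]_2 := ~` [set P; Q] in
  exists e : set (polyline R) -> cword,
    [/\ (forall l : polyline R, closed_polyline N l ->
           exists P' Q' : 'rV[R]_2, admissible_rays P Q l P' Q'),
        (forall l : polyline R, closed_polyline N l ->
         forall P' Q' : 'rV[R]_2, admissible_rays P Q l P' Q' ->
         forall v : cword,
           economical_form (poincare_word P P' Q Q' l) v <->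
           v = e (homotopy_class N l))
      & set_bij (homotopy_classes N) economical_words e].
Proof.
move=> N; exists (class_word P Q); split.
- by move=> l Nl; exact: admissible_rays_exist.
- by move=> l Nl P' Q' adm v; exact: poincare_class_word.
- exact: class_word_bij.
Qed.
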